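(* Let $r\ge2$ be a fixed integer, $a>b>0$ fixed, and $n=rK$. In the stochastic block model with $r$ clusters of equal size $K$, let $\widehat Z_{\mathrm{SDP}}$ be the solution of $$\max_Z\ \langle A,Z\rangle\quad\text{s.t.}\quad Z\succeq0,\ \ Z_{ii}=1\ (i\in[n]),\ \ Z_{ij}\ge0\ (i,j\in[n]),\ \ Z\mathbf 1=K\mathbf 1.$$ If $\sqrt a-\sqrt b>\sqrt r$, then $\min_{Z^*\in\mathcal Z_{n,r}}\mathbb P\{\widehat Z_{\mathrm{SDP}}=Z^*\}\ge1-n^{-\Omega(1)}$ as $n\to\infty$ (where $\widehat Z_{\mathrm{SDP}}=Z^*$ means $Z^*$ is the unique optimal solution).
   Context: SBM with $r$ equal-sized clusters: the vertex set $[n]$ is partitioned into clusters $C_1,\dots,C_r$ each of size $K$, with indicator vectors $\xi^*_k\in\{0,1\}^n$. Each pair $\{i,j\}$ is independently connected with probability $p=a\log n/n$ if $i,j$ are in the same cluster and $q=b\log n/n$ otherwise; $A$ is the adjacency matrix. $Z^*=\sum_{k=1}^r\xi^*_k(\xi^*_k)^\top$, and $\mathcal Z_{n,r}=\{\sum_{k=1}^r\xi_k\xi_k^\top:\xi_k\in\{0,1\}^n,\ \xi_k^\top\mathbf 1=K,\ \xi_k^\top\xi_{k'}=0\ (k\ne k')\}$. *)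

(* Defs.v *)
From Stdlib Require Import Reals List Arith Classical ClassicalEpsilon.
Import ListNotations.
Open Scope R_scope.

Definition rsum (n : nat) (f : nat -> R) : R :=
  fold_right Rplus 0 (map f (seq 0 n)).

(** Real n x n matrices are functions nat -> nat -> R, only indices < n matter. *)

Definition b2R (b : bool) : R := if b then 1 else 0.

Definition in_Znr (n r K : nat) (Z : nat -> nat -> R) : Prop :=
  exists xi : nat -> nat -> bool,
    (forall k, (k < r)%nat -> rsum n (fun i => b2R (xi k i)) = INR K) /\
    (forall k k', (k < r)%nat -> (k' < r)%nat -> k <> k' ->
        rsum n (fun i => b2R (xi k i) * b2R (xi k' i)) = 0) /\
    (forall i j, (i < n)%nat -> (j < n)%nat ->
        Z i j = rsum r (fun k => b2R (xi k i) * b2R (xi k j))).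

(** Random graphs: an edge configuration assigns a bool to each pair i<j. *)
Definition pairs (n : nat) : list (nat * nat) :=
  flat_map (fun j => map (fun i => (i, j)) (seq 0 j)) (seq 0 n).

Fixpoint configs (ps : list (nat * nat)) : list (nat -> nat -> bool) :=
  match ps with
  | nil => [fun _ _ => false]
  | (i, j) :: ps' =>
      flat_map (fun g => [g; fun x y => if andb (Nat.eqb x i) (Nat.eqb y j)
                                         then true else g x y]) (configs ps')
  end.

Definition adj (g : nat -> nat -> bool) (i j : nat) : R :=
  if Nat.ltb i j then b2R (g i j)
  else if Nat.ltb j i then b2R (g j i) else 0.

Definition edge_prob (p q : R) (Zs : nat -> nat -> R) (i j : nat) : R :=
  if Req_EM_T (Zs i j) 1 then p else q.

Definition weight (n : nat) (p q : R) (Zs : nat -> nat -> R)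
    (g : nat -> nat -> bool) : R :=
  fold_right Rmult 1
    (map (fun ij => let pij := edge_prob p q Zs (fst ij) (snd ij) in
                    if g (fst ij) (snd ij) then pij else 1 - pij) (pairs n)).

Definition indicator (P : Prop) : R :=
  if excluded_middle_informative P then 1 else 0.

Definition sbm_prob (n : nat) (p q : R) (Zs : nat -> nat -> R)
    (E : (nat -> nat -> R) -> Prop) : R :=
  fold_right Rplus 0
    (map (fun g => weight n p q Zs g * indicator (E (adj g))) (configs (pairs n))).

Definition sdp_feasible (n K : nat) (Z : nat -> nat -> R) : Prop :=
  (forall i j, (i < n)%nat -> (j < n)%nat -> Z i j = Z j i) /\
  (forall x : nat -> R, 0 <= rsum n (fun i => rsum n (fun j => x i * Z i j * x j))) /\
  (forall i, (i < n)%nat -> Z i i = 1) /\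
  (forall i j, (i < n)%nat -> (j < n)%nat -> 0 <= Z i j) /\
  (forall i, (i < n)%nat -> rsum n (fun j => Z i j) = INR K).

Definition sdp_obj (n : nat) (A Z : nat -> nat -> R) : R :=
  rsum n (fun i => rsum n (fun j => A i j * Z i j)).

Definition sdp_unique_opt (n K : nat) (A Zs : nat -> nat -> R) : Prop :=
  sdp_feasible n K Zs /\
  forall Z, sdp_feasible n K Z ->
    (exists i j, (i < n)%nat /\ (j < n)%nat /\ Z i j <> Zs i j) ->
    sdp_obj n A Z < sdp_obj n A Zs.

(* Main.v *)
Require Import Defs.
From Stdlib Require Import Reals List Arith Lia Lra Classical ClassicalEpsilon.
Import ListNotations.
Open Scope R_scope.

(** Weak duality: an explicit dual certificate [S], positive semidefinite and
    with null space spanned by the cluster indicators, proves that [Zs] is the unique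
    optimum. It exists as soon as (i) every vertex has more neighbours in its own
    cluster than in any other one, by a margin of order [log n], and (ii) the
    centred adjacency matrix has spectral norm at most a small multiple of
    [log n]. For (i), the Chernoff exponent is [(sqrt a - sqrt b)^2 / r > 1], which
    survives a union bound over [n] vertices. For (ii) it suffices that the cut
    norm is at most [eps n log n] (this handles spread out vectors), that degrees
    are [O(log n)], and that small vertex sets span few edges, so that the edges
    seen by the large coordinates form a subgraph of degeneracy [delta log n].
    Each failure is dominated pointwise by a sum of exponentials of linear forms
    in the adjacency matrix, whose expectations factorize over the edges. *)

(** * Finite sums *)

(** The centred adjacency matrix is known to have norm of order [sqrt (log n)], but the margin in
    (i) is a constant multiple of [log n], so any small multiple of [log n] will do. This slack lets
    union bounds replace random matrix theory. A cut deviation of size [eps n log n] has probability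
    at most [2 exp (- gam n log n)], which beats the [4^n] pairs of vertex sets for every fixed
    [eps]. The cut norm is too weak for vectors concentrated on few vertices; there the entropy of a
    set [T] is at most about [|T| log n], and a large but constant exponential tilt [lam3] defeats
    it. The constants form one chain: the slack [g] of the Chernoff exponent gives the margin [eta],
    then come [C], [alpha], [del], [lam3], [beta], [B], [eps], [lam1], each depending only on
    earlier ones and on [a], [b], [r]; only then is [n] taken large. All failure terms except that
    of the degree comparison are [O(1/n)], so the final exponent comes from [g], capped by a
    constant. *)

Definition lsum {X : Type} (l : list X) (f : X -> R) : R :=
  fold_right Rplus 0 (map f l).

Definition lprod {X : Type} (l : list X) (f : X -> R) : R :=
  fold_right Rmult 1 (map f l).

Lemma lsum_cons {X : Type} (x : X) (l : list X) (f : X -> R) :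
  lsum (x :: l) f = f x + lsum l f.
Proof. reflexivity. Qed.

Lemma lprod_cons {X : Type} (x : X) (l : list X) (f : X -> R) :
  lprod (x :: l) f = f x * lprod l f.
Proof. reflexivity. Qed.

Lemma lsum_ext {X : Type} (l : list X) (f g : X -> R) :
  (forall x, In x l -> f x = g x) -> lsum l f = lsum l g.
Proof.
  induction l as [|x l IH]; intros H; [reflexivity|].
  rewrite !lsum_cons, (H x), IH; [reflexivity| |left; reflexivity].
  intros y Hy; apply H; right; exact Hy.
Qed.

Lemma lprod_ext {X : Type} (l : list X) (f g : X -> R) :
  (forall x, In x l -> f x = g x) -> lprod l f = lprod l g.
Proof.
  induction l as [|x l IH]; intros H; [reflexivity|].
  rewrite !lprod_cons, (H x), IH; [reflexivity| |left; reflexivity].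
  intros y Hy; apply H; right; exact Hy.
Qed.

Lemma lsum_le {X : Type} (l : list X) (f g : X -> R) :
  (forall x, In x l -> f x <= g x) -> lsum l f <= lsum l g.
Proof.
  induction l as [|x l IH]; intros H; [apply Rle_refl|].
  rewrite !lsum_cons; apply Rplus_le_compat.
  - apply H; left; reflexivity.
  - apply IH; intros y Hy; apply H; right; exact Hy.
Qed.

Lemma lprod_le {X : Type} (l : list X) (f g : X -> R) :
  (forall x, In x l -> 0 <= f x <= g x) -> 0 <= lprod l f <= lprod l g.
Proof.
  induction l as [|x l IH]; intros H; [unfold lprod; simpl; lra|].
  rewrite !lprod_cons.
  assert (H1 := H x (or_introl eq_refl)).
  assert (H2 : 0 <= lprod l f <= lprod l g)
    by (apply IH; intros y Hy; apply H; right; exact Hy).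
  split; [apply Rmult_le_pos; lra|apply Rmult_le_compat; lra].
Qed.

Lemma lsum_plus {X : Type} (l : list X) (f g : X -> R) :
  lsum l (fun x => f x + g x) = lsum l f + lsum l g.
Proof.
  induction l as [|x l IH]; [unfold lsum; simpl; ring|].
  rewrite !lsum_cons, IH; ring.
Qed.

Lemma lsum_scal {X : Type} (l : list X) (k : R) (f : X -> R) :
  lsum l (fun x => k * f x) = k * lsum l f.
Proof.
  induction l as [|x l IH]; [unfold lsum; simpl; ring|].
  rewrite !lsum_cons, IH; ring.
Qed.

Lemma lsum_zero {X : Type} (l : list X) : lsum l (fun _ => 0) = 0.
Proof. induction l as [|x l IH]; [reflexivity|]; rewrite lsum_cons, IH; ring. Qed.

Lemma lsum_nonneg {X : Type} (l : list X) (f : X -> R) :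
  (forall x, In x l -> 0 <= f x) -> 0 <= lsum l f.
Proof. intros H; rewrite <- (lsum_zero l); apply lsum_le, H. Qed.

Lemma lsum_term_le {X : Type} (l : list X) (f : X -> R) (x : X) :
  (forall y, In y l -> 0 <= f y) -> In x l -> f x <= lsum l f.
Proof.
  induction l as [|y l IH]; intros H Hx; [destruct Hx|].
  rewrite lsum_cons; assert (H0 := H y (or_introl eq_refl)).
  assert (Hl : forall z, In z l -> 0 <= f z) by (intros z Hz; apply H; right; exact Hz).
  destruct Hx as [->|Hx].
  - assert (H1 := lsum_nonneg l f Hl); lra.
  - assert (H1 := IH Hl Hx); lra.
Qed.

Lemma lsum_app {X : Type} (l m : list X) (f : X -> R) :
  lsum (l ++ m) f = lsum l f + lsum m f.
Proof.
  induction l as [|x l IH]; [unfold lsum; simpl; ring|].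
  simpl app; rewrite !lsum_cons, IH; ring.
Qed.

Lemma lsum_map {X Y : Type} (h : X -> Y) (l : list X) (f : Y -> R) :
  lsum (map h l) f = lsum l (fun x => f (h x)).
Proof. unfold lsum; rewrite map_map; reflexivity. Qed.

Lemma lsum_flat_map {X Y : Type} (h : X -> list Y) (l : list X) (f : Y -> R) :
  lsum (flat_map h l) f = lsum l (fun x => lsum (h x) f).
Proof.
  induction l as [|x l IH]; [reflexivity|].
  simpl flat_map; rewrite lsum_app, lsum_cons, IH; reflexivity.
Qed.

Lemma lsum_swap {X Y : Type} (l : list X) (m : list Y) (f : X -> Y -> R) :
  lsum l (fun x => lsum m (f x)) = lsum m (fun y => lsum l (fun x => f x y)).
Proof.
  induction l as [|x l IH].
  - symmetry; apply lsum_zero.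
  - rewrite lsum_cons, IH, <- lsum_plus; apply lsum_ext; reflexivity.
Qed.

Lemma exp_lsum {X : Type} (l : list X) (f : X -> R) :
  exp (lsum l f) = lprod l (fun x => exp (f x)).
Proof.
  induction l as [|x l IH]; [apply exp_0|].
  rewrite lsum_cons, lprod_cons, exp_plus, IH; reflexivity.
Qed.

Lemma rsum_lsum (n : nat) (f : nat -> R) : rsum n f = lsum (seq 0 n) f.
Proof. reflexivity. Qed.

Lemma rsum_S (n : nat) (f : nat -> R) : rsum (S n) f = rsum n f + f n.
Proof.
  rewrite !rsum_lsum, seq_S, lsum_app; unfold lsum at 2; simpl; ring.
Qed.

Lemma rsum_ext (n : nat) (f g : nat -> R) :
  (forall i, (i < n)%nat -> f i = g i) -> rsum n f = rsum n g.
Proof. intros H; apply lsum_ext; intros x Hx; apply in_seq in Hx; apply H; lia. Qed.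

Lemma rsum_le (n : nat) (f g : nat -> R) :
  (forall i, (i < n)%nat -> f i <= g i) -> rsum n f <= rsum n g.
Proof. intros H; apply lsum_le; intros x Hx; apply in_seq in Hx; apply H; lia. Qed.

Lemma rsum_nonneg (n : nat) (f : nat -> R) :
  (forall i, (i < n)%nat -> 0 <= f i) -> 0 <= rsum n f.
Proof. intros H; apply lsum_nonneg; intros x Hx; apply in_seq in Hx; apply H; lia. Qed.

Lemma rsum_term_le (n : nat) (f : nat -> R) (i : nat) :
  (forall j, (j < n)%nat -> 0 <= f j) -> (i < n)%nat -> f i <= rsum n f.
Proof.
  intros H Hi; apply (lsum_term_le (seq 0 n) f i).
  - intros x Hx; apply in_seq in Hx; apply H; lia.
  - apply in_seq; lia.
Qed.

Lemma rsum_plus (n : nat) (f g : nat -> R) :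
  rsum n (fun i => f i + g i) = rsum n f + rsum n g.
Proof. apply lsum_plus. Qed.

Lemma rsum_scal (n : nat) (k : R) (f : nat -> R) :
  rsum n (fun i => k * f i) = k * rsum n f.
Proof. apply lsum_scal. Qed.

Lemma rsum_scal_r (n : nat) (k : R) (f : nat -> R) :
  rsum n (fun i => f i * k) = rsum n f * k.
Proof. rewrite Rmult_comm, <- rsum_scal; apply rsum_ext; intros; ring. Qed.

Lemma rsum_minus (n : nat) (f g : nat -> R) :
  rsum n (fun i => f i - g i) = rsum n f - rsum n g.
Proof.
  transitivity (rsum n f + -1 * rsum n g); [|ring].
  rewrite <- rsum_scal, <- rsum_plus; apply rsum_ext; intros; ring.
Qed.

Lemma rsum_zero (n : nat) : rsum n (fun _ => 0) = 0.
Proof. apply lsum_zero. Qed.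

Lemma rsum_eq0 (n : nat) (f : nat -> R) :
  (forall i, (i < n)%nat -> f i = 0) -> rsum n f = 0.
Proof. intros H; rewrite <- (rsum_zero n); apply rsum_ext, H. Qed.

Lemma rsum_nonneg_eq0 (n : nat) (f : nat -> R) (i : nat) :
  (forall j, (j < n)%nat -> 0 <= f j) -> rsum n f <= 0 -> (i < n)%nat -> f i = 0.
Proof.
  intros H H0 Hi; assert (H1 := rsum_term_le n f i H Hi); assert (H2 := H i Hi); lra.
Qed.

Lemma rsum_const (n : nat) (k : R) : rsum n (fun _ => k) = INR n * k.
Proof.
  induction n as [|n IH]; [unfold rsum; simpl; ring|].
  rewrite rsum_S, IH, S_INR; ring.
Qed.

Lemma rsum_swap (n m : nat) (f : nat -> nat -> R) :
  rsum n (fun i => rsum m (f i)) = rsum m (fun j => rsum n (fun i => f i j)).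
Proof. apply lsum_swap. Qed.

(** * Kronecker delta and double sums *)

Definition delta (i j : nat) : R := b2R (Nat.eqb i j).

Lemma delta_refl (i : nat) : delta i i = 1.
Proof. unfold delta; rewrite Nat.eqb_refl; reflexivity. Qed.

Lemma delta_neq (i j : nat) : i <> j -> delta i j = 0.
Proof. intros H; unfold delta; apply Nat.eqb_neq in H; rewrite H; reflexivity. Qed.

Lemma delta_sym (i j : nat) : delta i j = delta j i.
Proof. unfold delta; rewrite Nat.eqb_sym; reflexivity. Qed.

Lemma rsum_delta (n k : nat) (f : nat -> R) :
  (k < n)%nat -> rsum n (fun i => delta k i * f i) = f k.
Proof.
  induction n as [|n IH]; intros Hk; [lia|].
  rewrite rsum_S; destruct (Nat.eq_dec k n) as [->|Hne].
  - rewrite delta_refl, rsum_eq0; [ring|].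
    intros i Hi; rewrite delta_neq by lia; ring.
  - rewrite IH, delta_neq by lia; ring.
Qed.

Lemma b2R_range (x : bool) : 0 <= b2R x <= 1.
Proof. destruct x; simpl; lra. Qed.

Definition dsum (n : nat) (G : nat -> nat -> R) : R :=
  rsum n (fun i => rsum n (fun j => G i j)).

Lemma dsum_ext (n : nat) (F G : nat -> nat -> R) :
  (forall i j, (i < n)%nat -> (j < n)%nat -> F i j = G i j) -> dsum n F = dsum n G.
Proof. intros H; apply rsum_ext; intros i Hi; apply rsum_ext; auto. Qed.

Lemma dsum_le (n : nat) (F G : nat -> nat -> R) :
  (forall i j, (i < n)%nat -> (j < n)%nat -> F i j <= G i j) -> dsum n F <= dsum n G.
Proof. intros H; apply rsum_le; intros i Hi; apply rsum_le; auto. Qed.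

Lemma dsum_nonneg (n : nat) (F : nat -> nat -> R) :
  (forall i j, (i < n)%nat -> (j < n)%nat -> 0 <= F i j) -> 0 <= dsum n F.
Proof. intros H; apply rsum_nonneg; intros i Hi; apply rsum_nonneg; auto. Qed.

Lemma dsum_plus (n : nat) (F G : nat -> nat -> R) :
  dsum n (fun i j => F i j + G i j) = dsum n F + dsum n G.
Proof.
  unfold dsum; rewrite <- rsum_plus; apply rsum_ext; intros; apply rsum_plus.
Qed.

Lemma dsum_scal (n : nat) (k : R) (F : nat -> nat -> R) :
  dsum n (fun i j => k * F i j) = k * dsum n F.
Proof.
  unfold dsum; rewrite <- rsum_scal; apply rsum_ext; intros; apply rsum_scal.
Qed.

Lemma dsum_minus (n : nat) (F G : nat -> nat -> R) :
  dsum n (fun i j => F i j - G i j) = dsum n F - dsum n G.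
Proof.
  unfold dsum; rewrite <- rsum_minus; apply rsum_ext; intros; apply rsum_minus.
Qed.

Lemma dsum_transpose (n : nat) (F : nat -> nat -> R) :
  dsum n F = dsum n (fun i j => F j i).
Proof. apply rsum_swap. Qed.

Lemma dsum_mul (n : nat) (f g : nat -> R) :
  dsum n (fun i j => f i * g j) = rsum n f * rsum n g.
Proof.
  unfold dsum; rewrite <- rsum_scal_r; apply rsum_ext; intros; apply rsum_scal.
Qed.

Lemma dsum_delta (n v : nat) (G : nat -> nat -> R) :
  (v < n)%nat -> dsum n (fun i j => delta v i * G i j) = rsum n (fun j => G v j).
Proof.
  intros Hv; unfold dsum.
  rewrite (rsum_ext n _ (fun i => delta v i * rsum n (fun j => G i j)))
    by (intros; apply rsum_scal).
  apply (rsum_delta n v (fun i => rsum n (fun j => G i j)) Hv).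
Qed.

Lemma dsum_rows (n : nat) (G : nat -> nat -> R) (f : nat -> R) :
  dsum n (fun i j => f i * G i j) = rsum n (fun i => f i * rsum n (fun j => G i j)).
Proof. apply rsum_ext; intros; apply rsum_scal. Qed.

(** * Spectral norm of a sparse matrix *)

Definition sgn_pos (z : R) : bool := if Rle_dec 0 z then true else false.

Lemma mul_le_sgn (x z b : R) :
  Rabs x <= b -> x * z <= b * ((2 * b2R (sgn_pos z) - 1) * z).
Proof.
  intros Hx.
  assert (H : - b <= x <= b) by (unfold Rabs in Hx; destruct (Rcase_abs x); lra).
  unfold sgn_pos; destruct (Rle_dec 0 z); simpl; nra.
Qed.

(* A bilinear form on a cube is maximal at a sign vector pair, and a sign
   vector is the difference of two 0/1 vectors. *)
Lemma cut_norm_cube (n : nat) (M : nat -> nat -> R) (tau b : R) (x y : nat -> R) :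
  (forall S T : nat -> bool,
      - tau <= dsum n (fun i j => b2R (S i) * b2R (T j) * M i j) <= tau) ->
  0 <= b ->
  (forall i, (i < n)%nat -> Rabs (x i) <= b) ->
  (forall i, (i < n)%nat -> Rabs (y i) <= b) ->
  dsum n (fun i j => x i * y j * M i j) <= 4 * b * b * tau.
Proof.
  intros Hcut Hb Hx Hy.
  pose (z := fun i => rsum n (fun j => y j * M i j)).
  pose (P := fun i => sgn_pos (z i)).
  pose (s := fun i => 2 * b2R (P i) - 1).
  pose (u := fun j => rsum n (fun i => s i * M i j)).
  pose (Q := fun j => sgn_pos (u j)).
  pose (t := fun j => 2 * b2R (Q j) - 1).
  assert (H1 : dsum n (fun i j => x i * y j * M i j)
               <= b * dsum n (fun i j => s i * y j * M i j)).
  { rewrite <- dsum_scal; unfold dsum; apply rsum_le; intros i Hi.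
    transitivity (x i * z i);
      [right; unfold z; rewrite <- rsum_scal; apply rsum_ext; intros; ring|].
    transitivity (b * (s i * z i)); [apply mul_le_sgn, Hx, Hi|].
    right; unfold z; rewrite <- !rsum_scal; apply rsum_ext; intros; ring. }
  assert (H2 : dsum n (fun i j => s i * y j * M i j)
               <= b * dsum n (fun i j => s i * t j * M i j)).
  { rewrite <- dsum_scal.
    rewrite (dsum_transpose n (fun i j => s i * y j * M i j)).
    rewrite (dsum_transpose n (fun i j => b * _)).
    unfold dsum; apply rsum_le; intros i Hi.
    transitivity (y i * u i);
      [right; unfold u; rewrite <- rsum_scal; apply rsum_ext; intros; ring|].
    transitivity (b * (t i * u i)); [apply mul_le_sgn, Hy, Hi|].
    right; unfold u; rewrite <- !rsum_scal; apply rsum_ext; intros; ring. }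
  assert (H3 : dsum n (fun i j => s i * t j * M i j) <= 4 * tau).
  { pose (D := fun S T : nat -> bool => dsum n (fun i j => b2R (S i) * b2R (T j) * M i j)).
    assert (Hn : forall (B : nat -> bool) i, b2R (negb (B i)) = 1 - b2R (B i))
      by (intros B i; destruct (B i); simpl; ring).
    assert (E : dsum n (fun i j => s i * t j * M i j)
                = D P Q - D P (fun j => negb (Q j)) - D (fun i => negb (P i)) Q
                  + D (fun i => negb (P i)) (fun j => negb (Q j))).
    { unfold D; rewrite <- !dsum_minus, <- dsum_plus; apply dsum_ext; intros i j _ _.
      rewrite !Hn; unfold s, t; ring. }
    rewrite E; unfold D.
    assert (C1 := Hcut P Q). assert (C2 := Hcut P (fun j => negb (Q j))).
    assert (C3 := Hcut (fun i => negb (P i)) Q).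
    assert (C4 := Hcut (fun i => negb (P i)) (fun j => negb (Q j))). lra. }
  assert (H4 : b * dsum n (fun i j => s i * y j * M i j)
               <= b * (b * dsum n (fun i j => s i * t j * M i j)))
    by (apply Rmult_le_compat_l; assumption).
  assert (H5 : b * (b * dsum n (fun i j => s i * t j * M i j)) <= b * (b * (4 * tau)))
    by (apply Rmult_le_compat_l; [|apply Rmult_le_compat_l]; assumption).
  lra.
Qed.

(** One elimination step: [W] is [U] with the vertex [v] added, and the vanishing corner [G v v]
    leaves only the row and the column of [v] to account for. *)
Lemma dsum_remove (n v : nat) (W U : nat -> bool) (G : nat -> nat -> R) :
  (v < n)%nat -> (forall i, b2R (W i) = delta v i + b2R (U i)) -> G v v = 0 ->
  dsum n (fun i j => b2R (W i) * b2R (W j) * G i j)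
  = dsum n (fun i j => b2R (U i) * b2R (U j) * G i j)
    + rsum n (fun j => b2R (U j) * (G v j + G j v)).
Proof.
  intros Hv E HG.
  rewrite (dsum_ext n _ (fun i j => b2R (U i) * b2R (U j) * G i j
      + (delta v i * (b2R (U j) * G i j)
         + (delta v j * (b2R (U i) * G i j) + delta v i * (delta v j * G i j)))))
    by (intros; rewrite !E; ring).
  rewrite !dsum_plus.
  rewrite (dsum_transpose n (fun i j => delta v j * (b2R (U i) * G i j))).
  rewrite (dsum_delta n v (fun i j => b2R (U j) * G i j) Hv).
  rewrite (dsum_delta n v (fun i j => b2R (U j) * G j i) Hv).
  rewrite (dsum_delta n v (fun i j => delta v j * G i j) Hv).
  rewrite (rsum_delta n v (fun j => G v j) Hv), HG, Rplus_0_r, <- rsum_plus.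
  f_equal; apply rsum_ext; intros; ring.
Qed.

(* Removing a vertex [v] of low degree, the edges at [v] are charged by
   2 w_v w_j <= alpha w_v^2 + w_j^2 / alpha. *)
Lemma degenerate_quadratic_form (n : nat) (F : nat -> nat -> R) (w : nat -> R)
    (kappa alpha : R) :
  0 < alpha ->
  (forall i j, 0 <= F i j) -> (forall i j, F i j = F j i) -> (forall i, F i i = 0) ->
  (forall W : nat -> bool, 0 < rsum n (fun i => b2R (W i)) ->
     exists v, (v < n)%nat /\ W v = true /\
               rsum n (fun j => b2R (W j) * F v j) <= kappa) ->
  dsum n (fun i j => w i * w j * F i j)
  <= alpha * kappa * rsum n (fun i => w i * w i)
     + / alpha * dsum n (fun i j => w i * w i * F i j).
Proof.
  intros Ha F0 Fsym Fdiag Hdeg.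
  (* Both forms are restricted to a set [W], and the induction runs on a bound [k] for its size, so
     that vertices are removed along a degeneracy order. *)
  assert (Gen : forall k (W : nat -> bool), rsum n (fun i => b2R (W i)) <= INR k ->
    dsum n (fun i j => b2R (W i) * b2R (W j) * (w i * w j * F i j))
    <= alpha * kappa * rsum n (fun i => b2R (W i) * (w i * w i))
       + / alpha * dsum n (fun i j => b2R (W i) * b2R (W j) * (w i * w i * F i j))).
  { assert (Empty : forall W : nat -> bool, rsum n (fun i => b2R (W i)) <= 0 ->
      dsum n (fun i j => b2R (W i) * b2R (W j) * (w i * w j * F i j))
      <= alpha * kappa * rsum n (fun i => b2R (W i) * (w i * w i))
       + / alpha * dsum n (fun i j => b2R (W i) * b2R (W j) * (w i * w i * F i j))).
    { intros W HW.
      assert (W0 : forall i, (i < n)%nat -> b2R (W i) = 0).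
      { intros i Hi; apply (rsum_nonneg_eq0 n (fun i => b2R (W i))); auto.
        intros; apply b2R_range. }
      rewrite (dsum_ext n _ (fun _ _ => 0 * 0)) by (intros; rewrite W0 by auto; ring).
      rewrite (rsum_ext n _ (fun _ => 0)) by (intros; rewrite W0 by auto; ring).
      rewrite (dsum_ext n (fun i j => b2R (W i) * b2R (W j) * (w i * w i * F i j)) (fun _ _ => 0 * 0))
        by (intros; rewrite W0 by auto; ring).
      rewrite dsum_scal, rsum_zero; lra. }
    induction k as [|k IH]; intros W HW; [apply Empty, HW|].
    destruct (Rle_lt_dec (rsum n (fun i => b2R (W i))) 0) as [H0|Hpos];
      [apply Empty, H0|].
    destruct (Hdeg W Hpos) as (v & Hv & Wv & Hk).
    set (U := fun i => andb (W i) (negb (Nat.eqb v i))).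
    assert (E : forall i, b2R (W i) = delta v i + b2R (U i)).
    { intros i; unfold U, delta; destruct (Nat.eqb_spec v i) as [<-|].
      - rewrite Wv; simpl; ring.
      - rewrite Bool.andb_true_r; simpl; ring. }
    assert (HU : rsum n (fun i => b2R (U i)) <= INR k).
    { rewrite (rsum_ext n _ _ (fun i _ => E i)), rsum_plus, S_INR in HW.
      rewrite (rsum_ext n (delta v) (fun i => delta v i * 1)) in HW by (intros; ring).
      rewrite (rsum_delta n v (fun _ => 1) Hv) in HW; lra. }
    specialize (IH U HU).
    rewrite (dsum_remove n v W U (fun i j => w i * w j * F i j) Hv E)
      by (rewrite Fdiag; ring).
    rewrite (dsum_remove n v W U (fun i j => w i * w i * F i j) Hv E)
      by (rewrite Fdiag; ring).
    rewrite (rsum_ext n (fun i => b2R (W i) * (w i * w i))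
      (fun i => delta v i * (w i * w i) + b2R (U i) * (w i * w i)))
      by (intros; rewrite E; ring).
    rewrite rsum_plus, (rsum_delta n v (fun i => w i * w i) Hv).
    assert (K1 : rsum n (fun j => b2R (U j) * F v j) <= kappa).
    { apply Rle_trans with (2 := Hk); apply rsum_le; intros j Hj.
      apply Rmult_le_compat_r; [apply F0|].
      rewrite (E j); unfold delta; assert (R := b2R_range (Nat.eqb v j)); lra. }
    assert (K2 : rsum n (fun j => b2R (U j) * (w v * w j * F v j + w j * w v * F j v))
      <= alpha * (w v * w v) * rsum n (fun j => b2R (U j) * F v j)
         + / alpha * rsum n (fun j => b2R (U j) * (w v * w v * F v j + w j * w j * F j v))).
    { rewrite <- !rsum_scal, <- rsum_plus; apply rsum_le; intros j Hj.
      rewrite (Fsym j v).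
      assert (Hp : 0 <= b2R (U j) * F v j)
        by (apply Rmult_le_pos; [apply b2R_range|apply F0]).
      assert (Hi : 0 < / alpha) by (apply Rinv_0_lt_compat, Ha).
      assert (A : 2 * (w v * w j) <= alpha * (w v * w v) + / alpha * (w j * w j)).
      { assert (S := Rle_0_sqr (alpha * w v - w j)); unfold Rsqr in S.
        assert (S2 := Rmult_le_pos _ _ (Rlt_le _ _ Hi) S).
        replace (/ alpha * ((alpha * w v - w j) * (alpha * w v - w j)))
          with (alpha * (w v * w v) - 2 * (w v * w j) + / alpha * (w j * w j)) in S2
          by (field; lra).
        lra. }
      (* The second form counts every edge at [v] with [w v] squared as well as with [w j] squared;
         the former is surplus and is discarded by its sign. *)
      assert (B : 0 <= / alpha * (w v * w v))
        by (apply Rmult_le_pos; [lra|apply Rle_0_sqr]).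
      apply Rle_trans with ((b2R (U j) * F v j) * (2 * (w v * w j))); [right; ring|].
      apply Rle_trans with
        ((b2R (U j) * F v j)
         * (alpha * (w v * w v) + / alpha * (w j * w j) + / alpha * (w v * w v)));
        [apply Rmult_le_compat_l; lra|right; ring]. }
    assert (K3 : alpha * (w v * w v) * rsum n (fun j => b2R (U j) * F v j)
                 <= alpha * (w v * w v) * kappa).
    { apply Rmult_le_compat_l; [|exact K1].
      apply Rmult_le_pos; [lra|apply Rle_0_sqr]. }
    lra. }
  assert (H := Gen n (fun _ => true)).
  simpl b2R in H. rewrite rsum_const in H.
  rewrite (dsum_ext n (fun i j => 1 * 1 * (w i * w j * F i j)) (fun i j => w i * w j * F i j)) in H
    by (intros; ring).
  rewrite (dsum_ext n (fun i j => 1 * 1 * (w i * w i * F i j)) (fun i j => w i * w i * F i j)) in H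
    by (intros; ring).
  rewrite (rsum_ext n (fun i => 1 * (w i * w i)) (fun i => w i * w i)) in H by (intros; ring).
  apply H; lra.
Qed.

(** Double counting: the retained edges meet [H], so those inside [W] meet the intersection [S] of
    [W] and [H]. Their degree sum is at most twice the count between [S] and [W], hence at most
    [kappa] times the size of [W], and not all degrees in [W] can exceed [kappa]. *)
Lemma sparse_degenerate (n : nat) (A : nat -> nat -> R) (h kappa : R) (H W : nat -> bool) :
  (forall i j, 0 <= A i j) -> (forall i j, A i j = A j i) ->
  (forall S T : nat -> bool, (forall i, S i = true -> T i = true) ->
     rsum n (fun i => b2R (S i)) <= h ->
     dsum n (fun i j => b2R (S i) * b2R (T j) * A i j)
     <= kappa / 2 * rsum n (fun i => b2R (T i))) ->
  rsum n (fun i => b2R (H i)) <= h ->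
  0 < rsum n (fun i => b2R (W i)) ->
  exists v, (v < n)%nat /\ W v = true /\
    rsum n (fun j => b2R (W j) * (b2R (orb (H v) (H j)) * A v j)) <= kappa.
Proof.
  intros A0 Asym Hsp Hh Wpos; apply NNPP; intros Hno.
  pose (row := fun v => rsum n (fun j => b2R (W j) * (b2R (orb (H v) (H j)) * A v j))).
  assert (Hrow : forall v, (v < n)%nat -> W v = true -> kappa < row v).
  { intros v Hv HW; apply Rnot_le_lt; intros Hle; apply Hno; exists v; auto. }
  pose (S := fun i => andb (W i) (H i)).
  assert (Hsize : rsum n (fun i => b2R (S i)) <= h).
  { apply Rle_trans with (2 := Hh); apply rsum_le; intros i _; unfold S.
    destruct (W i), (H i); simpl; lra. }
  assert (HST : forall i, S i = true -> W i = true)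
    by (unfold S; intros i; destruct (W i); simpl; auto).
  assert (Hedges := Hsp S W HST Hsize).
  assert (Hcover : rsum n (fun i => b2R (W i) * row i)
    <= 2 * dsum n (fun i j => b2R (S i) * b2R (W j) * A i j)).
  { replace (2 * dsum n (fun i j => b2R (S i) * b2R (W j) * A i j))
      with (dsum n (fun i j => b2R (S i) * b2R (W j) * A i j)
            + dsum n (fun i j => b2R (S j) * b2R (W i) * A j i))
      by (rewrite <- (dsum_transpose n (fun i j => b2R (S i) * b2R (W j) * A i j)); ring).
    rewrite <- dsum_plus; unfold row; rewrite <- dsum_rows; apply dsum_le.
    intros i j _ _; rewrite (Asym j i); assert (HA := A0 i j); unfold S.
    destruct (W i), (W j), (H i), (H j); simpl; lra. }
  assert (Hexc : rsum n (fun i => b2R (W i) * (row i - kappa)) <= 0).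
  { rewrite (rsum_ext n _ (fun i => b2R (W i) * row i - kappa * b2R (W i)))
      by (intros; ring).
    rewrite rsum_minus, rsum_scal; lra. }
  assert (W0 : forall i, (i < n)%nat -> b2R (W i) = 0).
  { intros i Hi.
    assert (E : b2R (W i) * (row i - kappa) = 0).
    { apply (rsum_nonneg_eq0 n (fun i => b2R (W i) * (row i - kappa)) i); auto.
      intros j Hj; specialize (Hrow j Hj); destruct (W j); simpl; [|lra].
      specialize (Hrow eq_refl); lra. }
    specialize (Hrow i Hi); destruct (W i); simpl in *; [|reflexivity].
    specialize (Hrow eq_refl); lra. }
  rewrite (rsum_eq0 n _ W0) in Wpos; lra.
Qed.

(* Coordinates of modulus at most [B sigma], [sigma^2] being the mean square,
   are controlled by the cut norm; the few larger ones only meet edges of a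
   degenerate subgraph. *)
Lemma spectral_bound (n : nat) (A P : nat -> nat -> R)
    (tau Delta h kappa B alpha pmax : R) (w : nat -> R) :
  0 < B -> 0 < alpha -> INR n / (B * B) <= h -> 0 <= Delta -> 0 <= kappa -> 0 <= tau ->
  (forall i j, 0 <= A i j) -> (forall i j, A i j = A j i) -> (forall i, A i i = 0) ->
  0 <= pmax -> (forall i j, 0 <= P i j <= pmax) ->
  (forall S T : nat -> bool,
     - tau <= dsum n (fun i j => b2R (S i) * b2R (T j) * (A i j - P i j)) <= tau) ->
  (forall i, (i < n)%nat -> rsum n (fun j => A i j) <= Delta) ->
  (forall S T : nat -> bool, (forall i, S i = true -> T i = true) ->
     rsum n (fun i => b2R (S i)) <= h ->
     dsum n (fun i j => b2R (S i) * b2R (T j) * A i j)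
     <= kappa / 2 * rsum n (fun i => b2R (T i))) ->
  dsum n (fun i j => w i * w j * (A i j - P i j))
  <= (4 * B * B * tau / INR n + 2 * pmax * INR n / B + alpha * kappa + Delta / alpha)
     * rsum n (fun i => w i * w i).
Proof.
  intros HB Ha Hh HD Hkap Htau A0 Asym Adiag Hpm HP Hcut Hdeg Hsp.
  set (N := rsum n (fun i => w i * w i)).
  assert (sq0 : forall x : R, 0 <= x * x) by (intros; apply Rle_0_sqr).
  assert (HN : 0 <= N) by (apply rsum_nonneg; auto).
  destruct (Rle_lt_dec N 0) as [HN0|HNpos].
  { assert (w0 : forall i, (i < n)%nat -> w i = 0).
    { intros i Hi; apply Rsqr_0_uniq.
      apply (rsum_nonneg_eq0 n (fun i => w i * w i)); auto. }
    rewrite (dsum_ext n _ (fun _ _ => 0 * 0)) by (intros i j Hi Hj; rewrite (w0 i Hi); ring).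
    rewrite dsum_scal; replace N with 0 by lra; lra. }
  assert (Hn : 0 < INR n).
  { destruct n; [unfold N, rsum in HNpos; simpl in HNpos; lra|].
    rewrite S_INR; assert (X := pos_INR n); lra. }
  (* [sigma] is the root mean square of [w]; a coordinate is large, and marked by [H], when its
     modulus exceeds [B * sigma]. By Markov there are at most [n / B^2] of them. *)
  set (sigma := sqrt (N / INR n)).
  assert (Hs : 0 < sigma) by (apply sqrt_lt_R0, Rdiv_lt_0_compat; assumption).
  assert (Hs2 : INR n * (sigma * sigma) = N).
  { unfold sigma; rewrite sqrt_sqrt; [field; lra|].
    apply Rlt_le, Rdiv_lt_0_compat; assumption. }
  assert (HBs : 0 < B * sigma) by (apply Rmult_lt_0_compat; assumption).
  pose (H := fun i => if Rle_dec (Rabs (w i)) (B * sigma) then false else true).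
  pose (x := fun i => (1 - b2R (H i)) * w i).
  pose (v := fun i => Rabs (w i)).
  pose (F := fun i j => b2R (orb (H i) (H j)) * A i j).
  assert (v0 : forall i, 0 <= v i) by (intros; apply Rabs_pos).
  assert (vv : forall i, v i * v i = w i * w i)
    by (intros; unfold v; rewrite <- Rabs_mult; apply Rabs_pos_eq; auto).
  assert (Nv : rsum n (fun i => v i * v i) = N) by (apply rsum_ext; auto).
  assert (Hv : forall i, b2R (H i) * (B * sigma * v i) <= v i * v i).
  { intros i; assert (X := v0 i); unfold H; fold (v i).
    destruct (Rle_dec (v i) (B * sigma)); simpl; nra. }
  assert (Hsize : rsum n (fun i => b2R (H i)) <= h).
  { apply Rle_trans with (2 := Hh).
    assert (X : B * B * (sigma * sigma) * rsum n (fun i => b2R (H i)) <= N).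
    { rewrite <- Nv, <- rsum_scal; apply rsum_le; intros i _.
      assert (X := v0 i); unfold H; fold (v i).
      destruct (Rle_dec (v i) (B * sigma)); simpl; nra. }
    apply Rmult_le_reg_l with (B * B * (sigma * sigma));
      [apply Rmult_lt_0_compat; apply Rmult_lt_0_compat; assumption|].
    apply Rle_trans with (1 := X); right; rewrite <- Hs2; field; lra. }
  assert (Hbulk : dsum n (fun i j => x i * x j * (A i j - P i j))
                  <= 4 * (B * sigma) * (B * sigma) * tau).
  { assert (X : forall i, (i < n)%nat -> Rabs (x i) <= B * sigma).
    { intros i _; unfold x, H; destruct (Rle_dec (Rabs (w i)) (B * sigma)); simpl.
      - replace ((1 - 0) * w i) with (w i) by ring; assumption.
      - replace ((1 - 1) * w i) with 0 by ring; rewrite Rabs_R0; lra. }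
    apply cut_norm_cube; auto; lra. }
  assert (HF : dsum n (fun i j => v i * v j * F i j)
               <= alpha * kappa * N + / alpha * (Delta * N)).
  { apply Rle_trans with (alpha * kappa * rsum n (fun i => v i * v i)
                          + / alpha * dsum n (fun i j => v i * v i * F i j)).
    - apply degenerate_quadratic_form; auto.
      + intros i j; apply Rmult_le_pos; [apply b2R_range|apply A0].
      + intros i j; unfold F; rewrite (Asym i j), Bool.orb_comm; reflexivity.
      + intros i; unfold F; rewrite Adiag; ring.
      + intros W HW; apply (sparse_degenerate n A h kappa H W); auto.
    - rewrite Nv; apply Rplus_le_compat_l, Rmult_le_compat_l;
        [apply Rlt_le, Rinv_0_lt_compat, Ha|].
      rewrite dsum_rows, <- Nv, <- rsum_scal; apply rsum_le; intros i Hi.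
      rewrite Rmult_comm; apply Rmult_le_compat_r; [auto|].
      apply Rle_trans with (2 := Hdeg i Hi); apply rsum_le; intros j _.
      unfold F; assert (X := A0 i j); destruct (H i || H j)%bool; simpl; lra. }
  assert (Hsum : rsum n v <= INR n * sigma).
  { assert (X : 2 * sigma * rsum n v <= rsum n (fun i => v i * v i + sigma * sigma)).
    { rewrite <- rsum_scal; apply rsum_le; intros i _.
      assert (Y := sq0 (v i - sigma)); lra. }
    rewrite rsum_plus, Nv, rsum_const, <- Hs2 in X.
    apply Rmult_le_reg_l with (2 * sigma); lra. }
  (* A large coordinate satisfies [B * sigma * v i <= v i * v i], so the large ones have total mass
     at most [N / (B * sigma)]. *)
  assert (HsumH : B * rsum n (fun i => b2R (H i) * v i) <= INR n * sigma).
  { apply Rmult_le_reg_l with sigma; [assumption|].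
    apply Rle_trans with N; [|right; rewrite <- Hs2; ring].
    rewrite <- Nv, <- !rsum_scal; apply rsum_le; intros i _.
    assert (X := Hv i); lra. }
  assert (Hprod : dsum n (fun i j => b2R (H i) * v i * v j) <= INR n * N / B).
  { rewrite (dsum_mul n (fun i => b2R (H i) * v i) v).
    apply Rmult_le_reg_l with B; [assumption|].
    replace (B * (INR n * N / B)) with ((INR n * sigma) * (INR n * sigma))
      by (rewrite <- Hs2; field; lra).
    rewrite <- Rmult_assoc; apply Rmult_le_compat; auto.
    - apply Rmult_le_pos; [lra|]; apply rsum_nonneg; intros.
      apply Rmult_le_pos; [apply b2R_range|apply v0].
    - apply rsum_nonneg; auto. }
  assert (Hpm2 : pmax * dsum n (fun i j => b2R (H i) * v i * v j) <= pmax * (INR n * N / B))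
    by (apply Rmult_le_compat_l; assumption).
  (* If neither index is large, the term belongs to the form in [x]. Otherwise its [A] part goes to
     [F], and its [P] part, bounded by [pmax], is paid by the large row or column. *)
  assert (Hsplit : dsum n (fun i j => w i * w j * (A i j - P i j))
    <= dsum n (fun i j => x i * x j * (A i j - P i j))
       + dsum n (fun i j => v i * v j * F i j)
       + (pmax * dsum n (fun i j => b2R (H i) * v i * v j)
          + pmax * dsum n (fun i j => b2R (H j) * v j * v i))).
  { rewrite <- !dsum_scal, <- !dsum_plus; apply dsum_le; intros i j _ _.
    assert (Hw : Rabs (w i * w j) = v i * v j) by apply Rabs_mult.
    assert (X1 : w i * w j <= v i * v j) by (rewrite <- Hw; apply Rle_abs).
    assert (X2 : - (w i * w j) <= v i * v j)
      by (rewrite <- Hw, <- Rabs_Ropp; apply Rle_abs).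
    assert (X3 : 0 <= v i * v j) by (apply Rmult_le_pos; auto).
    assert (X4 := A0 i j). assert (X5 := HP i j).
    assert (X6 : w i * w j * (A i j - P i j) <= v i * v j * (A i j + pmax)) by nra.
    assert (X7 : 0 <= pmax * (v i * v j)) by (apply Rmult_le_pos; assumption).
    unfold x, F; destruct (H i), (H j); simpl; lra. }
  rewrite <- (dsum_transpose n (fun i j => b2R (H i) * v i * v j)) in Hsplit.
  replace ((4 * B * B * tau / INR n + 2 * pmax * INR n / B + alpha * kappa + Delta / alpha) * N)
    with (4 * (B * sigma) * (B * sigma) * tau + (alpha * kappa * N + / alpha * (Delta * N))
          + 2 * (pmax * (INR n * N / B)))
    by (rewrite <- Hs2; field; lra).
  lra.
Qed.

(** * Dual certificate *)

Lemma dsum_S (n : nat) (G : nat -> nat -> R) :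
  dsum (S n) G = dsum n G + rsum n (fun i => G i n) + rsum n (fun j => G n j) + G n n.
Proof.
  unfold dsum; rewrite rsum_S.
  rewrite (rsum_ext n _ (fun i => rsum n (fun j => G i j) + G i n))
    by (intros; apply rsum_S).
  rewrite rsum_plus, rsum_S; ring.
Qed.

Lemma dsum_rsum_swap (n m : nat) (G : nat -> nat -> nat -> R) :
  dsum n (fun i j => rsum m (fun k => G k i j)) = rsum m (fun k => dsum n (G k)).
Proof.
  unfold dsum; rewrite rsum_swap.
  rewrite (rsum_ext n _ (fun i => rsum m (fun k => rsum n (fun j => G k j i))))
    by (intros; apply rsum_swap).
  rewrite rsum_swap; apply rsum_ext; intros; apply rsum_swap.
Qed.

(** Cholesky factorization from the last index: its column divided by the root of the pivot [d] is
    one row of [V], and the Schur complement is factored by induction. It turns the pairing of [S]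
    with a feasible [Z] into a sum of values of the quadratic form of [S]. *)
Lemma psd_gram (n : nat) (Z : nat -> nat -> R) :
  (forall i j, (i < n)%nat -> (j < n)%nat -> Z i j = Z j i) ->
  (forall x : nat -> R, 0 <= dsum n (fun i j => x i * x j * Z i j)) ->
  exists V : nat -> nat -> R, forall i j, (i < n)%nat -> (j < n)%nat ->
    Z i j = rsum n (fun k => V k i * V k j).
Proof.
  revert Z; induction n as [|n IH]; intros Z Zsym Zpsd.
  { exists (fun _ _ => 0); intros; lia. }
  pose (z := fun i => Z i n). set (d := Z n n).
  assert (Hborder : forall (x : nat -> R) t,
    0 <= dsum n (fun i j => x i * x j * Z i j) + 2 * t * rsum n (fun i => z i * x i) + t * t * d).
  { intros x t; assert (P := Zpsd (fun i => if Nat.eqb i n then t else x i)).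
    rewrite dsum_S, !Nat.eqb_refl in P.
    rewrite (dsum_ext n _ (fun i j => x i * x j * Z i j)) in P.
    2:{ intros i j Hi Hj; rewrite (proj2 (Nat.eqb_neq i n)), (proj2 (Nat.eqb_neq j n)) by lia;
        reflexivity. }
    rewrite (rsum_ext n _ (fun i => t * (z i * x i))) in P.
    2:{ intros i Hi; rewrite (proj2 (Nat.eqb_neq i n)) by lia; unfold z; ring. }
    rewrite (rsum_ext n (fun j => t * _ * Z n j) (fun i => t * (z i * x i))) in P.
    2:{ intros i Hi; rewrite (proj2 (Nat.eqb_neq i n)), (Zsym n i) by lia; unfold z; ring. }
    rewrite !rsum_scal in P; fold d in P; lra. }
  assert (Hd : 0 <= d).
  { assert (P := Hborder (fun _ => 0) 1).
    rewrite (dsum_ext n _ (fun _ _ => 0 * 0)), dsum_scal in P by (intros; ring).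
    rewrite (rsum_eq0 n (fun i => z i * 0)) in P by (intros; ring); lra. }
  (* A zero pivot forces a zero column: otherwise the form is affine in [t] along [z] with nonzero
     slope, and the [t] below makes it equal to [-1]. The divisions by [sqrt d] in [g] are then
     harmless, their numerators being zero. *)
  assert (Hz : d = 0 -> forall i, (i < n)%nat -> z i = 0).
  { intros Hd0.
    assert (Hzz : rsum n (fun i => z i * z i) <= 0).
    { destruct (Rle_lt_dec (rsum n (fun i => z i * z i)) 0) as [|Hpos]; [assumption|].
      assert (P := Hborder z (- (dsum n (fun i j => z i * z j * Z i j) + 1)
                              / (2 * rsum n (fun i => z i * z i)))).
      exfalso; apply (Rle_not_lt _ _ P); rewrite Hd0.
      apply Rle_lt_trans with (-1); [right; field; lra|lra]. }
    intros i Hi; apply Rsqr_0_uniq, (rsum_nonneg_eq0 n (fun i => z i * z i)); auto.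
    intros; apply Rle_0_sqr. }
  pose (g := fun i => Z i n / sqrt d).
  assert (Hg : forall i, (i < S n)%nat -> g i * g n = Z i n).
  { intros i Hi; unfold g; fold d; destruct (Req_dec d 0) as [Hd0|Hd0].
    - replace (Z i n) with 0; [unfold Rdiv; ring|].
      destruct (Nat.eq_dec i n) as [->|]; [symmetry; assumption|].
      symmetry; apply Hz; [assumption|lia].
    - assert (Hs : sqrt d <> 0) by (apply Rgt_not_eq, sqrt_lt_R0; lra).
      rewrite <- (sqrt_sqrt d) at 2 by assumption; field; assumption. }
  destruct (IH (fun i j => Z i j - g i * g j)) as [V HV].
  { intros i j Hi Hj; rewrite (Zsym i j) by lia; ring. }
  { intros x.
    rewrite (dsum_ext n _ (fun i j => x i * x j * Z i j - (g i * x i) * (g j * x j)))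
      by (intros; ring).
    rewrite dsum_minus, (dsum_mul n (fun i => g i * x i) (fun j => g j * x j)).
    destruct (Req_dec d 0) as [Hd0|Hd0].
    - rewrite (rsum_eq0 n (fun i => g i * x i)).
      + assert (P := Hborder x 0); lra.
      + intros i Hi; unfold g; fold (z i); rewrite (Hz Hd0 i Hi); unfold Rdiv; ring.
    - assert (Hs : 0 < sqrt d) by (apply sqrt_lt_R0; lra).
      (* This [t] minimizes the bordered form for given [x]; the minimum is the Schur complement. *)
      assert (P := Hborder x (- rsum n (fun i => z i * x i) / d)).
      rewrite (rsum_ext n (fun i => g i * x i) (fun i => / sqrt d * (z i * x i)))
        by (intros; unfold g, z; field; lra).
      rewrite rsum_scal.
      replace (/ sqrt d * rsum n (fun i => z i * x i) * (/ sqrt d * rsum n (fun i => z i * x i)))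
        with (rsum n (fun i => z i * x i) * rsum n (fun i => z i * x i) / d)
        by (rewrite <- (sqrt_sqrt d) at 1 by assumption; field; lra).
      apply Rle_trans with (1 := P); right; field; lra. }
  exists (fun k i => if Nat.eqb k n then g i else if Nat.eqb i n then 0 else V k i).
  intros i j Hi Hj; rewrite rsum_S, Nat.eqb_refl.
  destruct (Nat.eqb_spec i n) as [->|Hin].
  - rewrite rsum_eq0.
    + rewrite Zsym, <- (Hg j Hj) by lia; ring.
    + intros k Hk; rewrite (proj2 (Nat.eqb_neq k n)) by lia; ring.
  - destruct (Nat.eqb_spec j n) as [->|Hjn].
    + rewrite rsum_eq0, (Hg i Hi); [ring|].
      intros k Hk; rewrite (proj2 (Nat.eqb_neq k n)) by lia; ring.
    + rewrite (rsum_ext n _ (fun k => V k i * V k j)).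
      * rewrite <- HV by lia; ring.
      * intros k Hk; rewrite (proj2 (Nat.eqb_neq k n)) by lia; reflexivity.
Qed.

(** Vectors constant on clusters lie in the kernel of [S], so they can be subtracted from [v]. With
    [u] the cluster averages, positivity need only be checked on vectors whose cluster sums
    vanish. *)
Lemma quadratic_form_shift (n r : nat) (c : nat -> nat) (S : nat -> nat -> R) (v u : nat -> R) :
  (forall i, (i < n)%nat -> (c i < r)%nat) ->
  (forall i j, (i < n)%nat -> (j < n)%nat -> S i j = S j i) ->
  (forall i l, (i < n)%nat -> (l < r)%nat -> rsum n (fun j => delta (c j) l * S i j) = 0) ->
  let w := fun i => v i - u (c i) in
  dsum n (fun i j => v i * v j * S i j) = dsum n (fun i j => w i * w j * S i j).
Proof.
  intros Hc Ssym Sblock w.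
  assert (Hu : forall i, (i < n)%nat -> rsum n (fun j => u (c j) * S i j) = 0).
  { intros i Hi.
    rewrite (rsum_ext n _ (fun j => rsum r (fun l => delta (c j) l * (u l * S i j)))).
    - rewrite rsum_swap; apply rsum_eq0; intros l Hl.
      rewrite (rsum_ext n _ (fun j => u l * (delta (c j) l * S i j))) by (intros; ring).
      rewrite rsum_scal, Sblock by assumption; ring.
    - intros j Hj; symmetry; apply (rsum_delta r (c j) (fun l => u l * S i j)); auto. }
  assert (Hshift : forall y : nat -> R,
    dsum n (fun i j => y i * (v j * S i j)) = dsum n (fun i j => y i * (w j * S i j))).
  { intros y; rewrite !dsum_rows; apply rsum_ext; intros i Hi; f_equal.
    rewrite (rsum_ext n (fun j => w j * S i j) (fun j => v j * S i j - u (c j) * S i j))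
      by (intros; unfold w; ring).
    rewrite rsum_minus, Hu by assumption; ring. }
  transitivity (dsum n (fun i j => v i * (v j * S i j))); [apply dsum_ext; intros; ring|].
  rewrite Hshift, dsum_transpose.
  transitivity (dsum n (fun i j => w i * (v j * S i j))).
  { apply dsum_ext; intros i j Hi Hj; rewrite (Ssym j i) by assumption; ring. }
  rewrite Hshift; apply dsum_ext; intros; ring.
Qed.

(** For fixed [i] the weight [phi i (c j)] depends on [j] through its cluster only, and the cluster
    sums of [w] vanish. This serves twice: for the term [R] of the certificate and for the mean of
    the adjacency matrix, up to its diagonal. *)
Lemma additive_form_vanishes (n r : nat) (c : nat -> nat) (phi : nat -> nat -> R) (w : nat -> R) :
  (forall i, (i < n)%nat -> (c i < r)%nat) ->
  (forall l, (l < r)%nat -> rsum n (fun j => delta (c j) l * w j) = 0) ->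
  dsum n (fun i j => w i * w j * (phi i (c j) + phi j (c i))) = 0.
Proof.
  intros Hc Hw.
  assert (H : dsum n (fun i j => w i * (w j * phi i (c j))) = 0).
  { rewrite dsum_rows; apply rsum_eq0; intros i Hi.
    rewrite (rsum_ext n _ (fun j => rsum r (fun l => delta (c j) l * (w j * phi i l)))).
    - rewrite rsum_swap, rsum_eq0; [ring|]; intros l Hl.
      rewrite (rsum_ext n _ (fun j => delta (c j) l * w j * phi i l)) by (intros; ring).
      rewrite rsum_scal_r, Hw by assumption; ring.
    - intros j Hj; symmetry; apply (rsum_delta r (c j) (fun l => w j * phi i l)); auto. }
  rewrite (dsum_ext n _ (fun i j => w i * (w j * phi i (c j)) + w j * (w i * phi j (c i))))
    by (intros; ring).
  rewrite dsum_plus, <- (dsum_transpose n (fun i j => w i * (w j * phi i (c j)))), H; ring.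
Qed.

Lemma cluster_matrix_feasible (n r K : nat) (c : nat -> nat) (Zs : nat -> nat -> R) :
  (forall i, (i < n)%nat -> (c i < r)%nat) ->
  (forall l, (l < r)%nat -> rsum n (fun i => delta (c i) l) = INR K) ->
  (forall i j, (i < n)%nat -> (j < n)%nat -> Zs i j = delta (c i) (c j)) ->
  sdp_feasible n K Zs.
Proof.
  intros Hc Hsize HZ; repeat split.
  - intros i j Hi Hj; rewrite !HZ by assumption; apply delta_sym.
  - intros x.
    change (0 <= dsum n (fun i j => x i * Zs i j * x j)).
    rewrite (dsum_ext n _ (fun i j => rsum r (fun l => (delta (c i) l * x i) * (delta (c j) l * x j)))).
    + rewrite (dsum_rsum_swap n r (fun l i j => (delta (c i) l * x i) * (delta (c j) l * x j))).
      apply rsum_nonneg; intros l Hl.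
      rewrite (dsum_mul n (fun i => delta (c i) l * x i) (fun j => delta (c j) l * x j)).
      apply Rle_0_sqr.
    + intros i j Hi Hj; rewrite HZ by assumption.
      rewrite (rsum_ext r _ (fun l => delta (c i) l * (x i * (delta l (c j) * x j))))
        by (intros; rewrite (delta_sym (c j)); ring).
      rewrite (rsum_delta r (c i) (fun l => x i * (delta l (c j) * x j))) by auto; ring.
  - intros i Hi; rewrite HZ by assumption; apply delta_refl.
  - intros i j Hi Hj; rewrite HZ by assumption; apply b2R_range.
  - intros i Hi; rewrite <- (Hsize (c i)) by auto; apply rsum_ext; intros j Hj.
    rewrite HZ by assumption; apply delta_sym.
Qed.

(* The dual certificate is [S = D - A + R]: [R] has the additive form
   [phi i (c j) + phi j (c i)], hence is invisible to vectors summing to zero on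
   each cluster, and [phi] makes every cluster indicator a null vector of [S].
   The multiplier of [Z >= 0] is [B i j = lam i + lam j - R i j]. *)
Lemma sdp_dual_certificate (n r K : nat) (c : nat -> nat) (A Zs : nat -> nat -> R)
    (m : nat -> R) (T s rho : R) :
  (1 <= K)%nat ->
  (forall i, (i < n)%nat -> (c i < r)%nat) ->
  (forall l, (l < r)%nat -> rsum n (fun i => delta (c i) l) = INR K) ->
  (forall i j, (i < n)%nat -> (j < n)%nat -> Zs i j = delta (c i) (c j)) ->
  (forall i j, A i j = A j i) ->
  let e := fun i l => rsum n (fun j => delta (c j) l * A i j) in
  (forall i l, (i < n)%nat -> (l < r)%nat -> l <> c i -> e i l <= m i) ->
  (forall l, (l < r)%nat -> rsum n (fun j => delta (c j) l * m j) <= INR K * (T + s)) ->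
  (forall k l, (k < r)%nat -> (l < r)%nat -> k <> l ->
     INR K * (T - 2 * s) <= rsum n (fun i => delta (c i) k * e i l)) ->
  (forall i, (i < n)%nat -> m i + 3 * s + rho < e i (c i)) ->
  (forall w : nat -> R, (forall l, (l < r)%nat -> rsum n (fun i => delta (c i) l * w i) = 0) ->
     dsum n (fun i j => w i * w j * A i j) <= rho * rsum n (fun i => w i * w i)) ->
  sdp_unique_opt n K A Zs.
Proof.
  intros HK Hc Hsize HZs Asym e Hm Havg Hlow Hthr Hspec.
  assert (Kpos : 0 < INR K) by (apply lt_0_INR; lia).
  split; [apply (cluster_matrix_feasible n r K c); assumption|].
  (* With [T] the typical number of neighbours in a foreign cluster, the shift [s - T / 2] balances
     two needs: [B] stays nonnegative between clusters, where the average count may fall to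
     [T - 2 * s], while [Lam] stays below [T / 2 + 2 * s]. Together they cost the [3 * s] in the
     margin. *)
  pose (lam := fun i => (m i + s - T / 2) / INR K).
  pose (Lam := fun k => rsum n (fun j => delta (c j) k * lam j)).
  pose (E := fun k l => rsum n (fun i => delta (c i) k * e i l)).
  (* Solves the null vector equation of row [i] on its own cluster, where
     [Rm i j = lam i + lam j]. *)
  pose (d := fun i => e i (c i) - INR K * lam i - Lam (c i)).
  (* On the own cluster, [phi = lam] makes [B] vanish, as complementary slackness demands. On
     another cluster [l], the null vector equation asks that [K * phi i l] plus the sum of
     [phi j (c i)] over [j] in [l] be [e i l]; the correction by the total [E] is split evenly
     between the two sides. *)
  pose (phi := fun i l => if Nat.eqb l (c i) then lam i
                          else e i l / INR K - E (c i) l / (2 * INR K * INR K)).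
  pose (Rm := fun i j => phi i (c j) + phi j (c i)).
  pose (S := fun i j => delta i j * d i - A i j + Rm i j).
  pose (B := fun i j => lam i + lam j - Rm i j).
  assert (Esym : forall k l, E k l = E l k).
  { intros k l; unfold E, e.
    transitivity (dsum n (fun i j => delta (c i) k * (delta (c j) l * A i j)));
      [symmetry; apply dsum_rows|].
    rewrite dsum_transpose.
    transitivity (dsum n (fun i j => delta (c i) l * (delta (c j) k * A i j)));
      [|apply dsum_rows].
    apply dsum_ext; intros i j _ _; rewrite (Asym j i); ring. }
  assert (HLam : forall k, (k < r)%nat -> Lam k <= T / 2 + 2 * s).
  { intros k Hk; unfold Lam, lam.
    rewrite (rsum_ext n _ (fun j => / INR K * (delta (c j) k * m j)
                                    + (s - T / 2) / INR K * delta (c j) k))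
      by (intros; field; lra).
    rewrite rsum_plus, !rsum_scal, Hsize by assumption.
    assert (X := Havg k Hk).
    apply Rmult_le_compat_l with (r := / INR K) in X;
      [|apply Rlt_le, Rinv_0_lt_compat, Kpos].
    replace (/ INR K * (INR K * (T + s))) with (T + s) in X by (field; lra).
    replace ((s - T / 2) / INR K * INR K) with (s - T / 2) by (field; lra); lra. }
  assert (Hd : forall i, (i < n)%nat -> rho < d i).
  { intros i Hi; unfold d; assert (X := HLam (c i) (Hc i Hi)); assert (Y := Hthr i Hi).
    replace (INR K * lam i) with (m i + s - T / 2) by (unfold lam; field; lra); lra. }
  assert (HB0 : forall i j, c i = c j -> B i j = 0).
  { intros i j Hij; unfold B, Rm, phi; rewrite Hij, Nat.eqb_refl; ring. }
  assert (HB : forall i j, (i < n)%nat -> (j < n)%nat -> 0 <= B i j).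
  { intros i j Hi Hj; destruct (Nat.eq_dec (c i) (c j)) as [Hij|Hij];
      [rewrite HB0 by assumption; lra|].
    unfold B, Rm, phi.
    rewrite (proj2 (Nat.eqb_neq (c j) (c i))), (proj2 (Nat.eqb_neq (c i) (c j))) by auto.
    rewrite (Esym (c j) (c i)).
    assert (X1 := Hm i (c j) Hi (Hc j Hj) (not_eq_sym Hij)).
    assert (X2 := Hm j (c i) Hj (Hc i Hi) Hij).
    assert (X3 := Hlow (c i) (c j) (Hc i Hi) (Hc j Hj) Hij).
    fold (E (c i) (c j)) in X3.
    replace (lam i + lam j - _) with
      (/ INR K * ((m i - e i (c j)) + (m j - e j (c i))
                  + / INR K * (E (c i) (c j) - INR K * (T - 2 * s))))
      by (unfold lam; field; lra).
    assert (Hi' : 0 < / INR K) by (apply Rinv_0_lt_compat, Kpos).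
    apply Rmult_le_pos; [lra|].
    assert (0 <= / INR K * (E (c i) (c j) - INR K * (T - 2 * s)))
      by (apply Rmult_le_pos; lra).
    lra. }
  assert (Ssym : forall i j, S i j = S j i).
  { intros i j; unfold S, Rm; rewrite (Asym i j); destruct (Nat.eq_dec i j) as [->|Hij];
      [ring|rewrite !delta_neq by auto; ring]. }
  assert (Sblock : forall i l, (i < n)%nat -> (l < r)%nat ->
    rsum n (fun j => delta (c j) l * S i j) = 0).
  { intros i l Hi Hl.
    rewrite (rsum_ext n _ (fun j => delta i j * (delta (c j) l * d i)
        - delta (c j) l * A i j + (phi i l * delta (c j) l + delta (c j) l * phi j (c i)))).
    2:{ intros j Hj; unfold S, Rm; destruct (Nat.eq_dec (c j) l) as [<-|Hne];
        [rewrite delta_refl|rewrite !(delta_neq (c j) l) by assumption]; ring. }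
    rewrite !rsum_plus, rsum_minus, rsum_scal, Hsize by assumption.
    rewrite (rsum_delta n i (fun j => delta (c j) l * d i) Hi); fold (e i l).
    destruct (Nat.eq_dec (c i) l) as [Hcl|Hcl].
    - rewrite (rsum_ext n _ (fun j => delta (c j) l * lam j)).
      + fold (Lam l); unfold phi, d; rewrite Hcl, Nat.eqb_refl, delta_refl; ring.
      + intros j Hj; destruct (Nat.eq_dec (c j) l) as [Hj'|Hj'].
        * unfold phi; rewrite Hcl, Hj', Nat.eqb_refl; ring.
        * rewrite !delta_neq by assumption; ring.
    - rewrite (rsum_ext n _ (fun j => / INR K * (delta (c j) l * e j (c i))
            + - (E l (c i) / (2 * INR K * INR K)) * delta (c j) l)).
      + rewrite rsum_plus, !rsum_scal, Hsize by assumption; fold (E l (c i)).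
        unfold phi; rewrite (proj2 (Nat.eqb_neq l (c i))), (delta_neq (c i) l), (Esym (c i) l)
          by auto.
        field; lra.
      + intros j Hj; destruct (Nat.eq_dec (c j) l) as [Hj'|Hj'].
        * unfold phi; rewrite Hj', (proj2 (Nat.eqb_neq (c i) l)) by auto; field; lra.
        * rewrite !delta_neq by assumption; ring. }
  assert (Squad : forall v : nat -> R,
    let w := fun i => v i - / INR K * rsum n (fun j => delta (c j) (c i) * v j) in
    rsum n (fun i => (d i - rho) * (w i * w i)) <= dsum n (fun i j => v i * v j * S i j)).
  { intros v w.
    rewrite (quadratic_form_shift n r c S v
      (fun k => / INR K * rsum n (fun j => delta (c j) k * v j)) Hc (fun i j _ _ => Ssym i j) Sblock).
    fold w. change (rsum n (fun i => (d i - rho) * (w i * w i))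
                    <= dsum n (fun i j => w i * w j * S i j)).
    assert (Hw : forall l, (l < r)%nat -> rsum n (fun i => delta (c i) l * w i) = 0).
    { intros l Hl.
      rewrite (rsum_ext n _ (fun i => delta (c i) l * v i
        - / INR K * rsum n (fun j => delta (c j) l * v j) * delta (c i) l)).
      - rewrite rsum_minus, rsum_scal, Hsize by assumption; field; lra.
      - intros i Hi; unfold w; destruct (Nat.eq_dec (c i) l) as [->|Hne];
          [ring|rewrite !(delta_neq (c i) l) by assumption; ring]. }
    rewrite (dsum_ext n _ (fun i j => delta i j * (w i * w j * d i) - w i * w j * A i j
                                      + w i * w j * Rm i j)) by (intros; unfold S; ring).
    rewrite dsum_plus, dsum_minus; unfold Rm.
    rewrite (additive_form_vanishes n r c phi w Hc Hw).
    replace (dsum n (fun i j => delta i j * (w i * w j * d i)))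
      with (rsum n (fun i => d i * (w i * w i))).
    2:{ apply rsum_ext; intros i Hi.
        rewrite (rsum_delta n i (fun j => w i * w j * d i) Hi); ring. }
    rewrite (rsum_ext n _ (fun i => d i * (w i * w i) - rho * (w i * w i)))
      by (intros; ring).
    rewrite rsum_minus, rsum_scal; assert (X := Hspec w Hw); lra. }
  (* [S + A + B] has entries [delta i j * d i + lam i + lam j], whose pairing with [Z] is fixed by
     the unit diagonal and the row sums [K]. The duality gap of [Z] is thus its pairing with [S] and
     [B]. *)
  assert (Hobj : forall Z, sdp_feasible n K Z ->
    dsum n (fun i j => S i j * Z i j) + dsum n (fun i j => B i j * Z i j) + sdp_obj n A Z
    = rsum n d + 2 * INR K * rsum n lam).
  { intros Z (Zsym & _ & Zdiag & _ & Zrow).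
    change (sdp_obj n A Z) with (dsum n (fun i j => A i j * Z i j)).
    rewrite <- !dsum_plus.
    rewrite (dsum_ext n _ (fun i j => delta i j * (d i * Z i j)
                                      + (lam i * Z i j + lam j * Z j i))).
    2:{ intros i j Hi Hj; unfold S, B; rewrite (Zsym j i) by assumption; ring. }
    rewrite !dsum_plus, <- (dsum_transpose n (fun i j => lam i * Z i j)), dsum_rows.
    rewrite (rsum_ext n (fun i => lam i * _) (fun i => INR K * lam i))
      by (intros i Hi; rewrite Zrow by assumption; ring).
    rewrite rsum_scal.
    replace (dsum n (fun i j => delta i j * (d i * Z i j))) with (rsum n d); [ring|].
    apply rsum_ext; intros i Hi.
    rewrite (rsum_delta n i (fun j => d i * Z i j) Hi), Zdiag by assumption; ring. }
  assert (HobjZs : sdp_obj n A Zs = rsum n d + 2 * INR K * rsum n lam).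
  { rewrite <- (Hobj Zs) by (apply (cluster_matrix_feasible n r K c); assumption).
    assert (X1 : dsum n (fun i j => S i j * Zs i j) = 0).
    { apply rsum_eq0; intros i Hi; rewrite <- (Sblock i (c i)) by auto.
      apply rsum_ext; intros j Hj; rewrite HZs, delta_sym by assumption; ring. }
    assert (X2 : dsum n (fun i j => B i j * Zs i j) = 0).
    { apply rsum_eq0; intros i Hi; apply rsum_eq0; intros j Hj; rewrite HZs by assumption.
      destruct (Nat.eq_dec (c i) (c j)) as [Hij|Hij];
        [rewrite HB0 by assumption; ring|rewrite delta_neq by assumption; ring]. }
    lra. }
  intros Z HZ (i0 & j0 & Hi0 & Hj0 & Hne).
  assert (HobjZ := Hobj Z HZ).
  destruct HZ as (Zsym & Zpsd & Zdiag & Zpos & Zrow).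
  apply Rnot_le_lt; intros Hge; apply Hne; clear Hne.
  assert (HBZ : 0 <= dsum n (fun i j => B i j * Z i j))
    by (apply dsum_nonneg; intros; apply Rmult_le_pos; auto).
  destruct (psd_gram n Z Zsym) as [V HV].
  { intros x; apply Rle_trans with (1 := Zpsd x); right.
    apply dsum_ext; intros; ring. }
  (* A competitor at least as good as [Zs] has no gap. With [Z] written as a Gram matrix, every row
     of [V] annihilates the form of [S] and is therefore constant on clusters. *)
  assert (HSZ : rsum n (fun k => dsum n (fun i j => V k i * V k j * S i j)) <= 0).
  { rewrite <- (dsum_rsum_swap n n (fun k i j => V k i * V k j * S i j)).
    rewrite (dsum_ext n _ (fun i j => S i j * Z i j)); [lra|].
    intros i j Hi Hj; rewrite HV by assumption; rewrite rsum_scal_r; ring. }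
  pose (W := fun k i => V k i - / INR K * rsum n (fun j => delta (c j) (c i) * V k j)).
  assert (Hterm : forall k i, (i < n)%nat -> 0 <= (d i - rho) * (W k i * W k i)).
  { intros k i Hi; apply Rmult_le_pos; [|apply Rle_0_sqr].
    assert (X := Hd i Hi); lra. }
  assert (HW : forall k i, (k < n)%nat -> (i < n)%nat -> W k i = 0).
  { intros k i Hk Hi.
    assert (X : dsum n (fun i j => V k i * V k j * S i j) = 0).
    { apply (rsum_nonneg_eq0 n (fun k => dsum n (fun i j => V k i * V k j * S i j))); auto.
      intros k' _; apply Rle_trans with (2 := Squad (V k')).
      apply rsum_nonneg; intros; apply (Hterm k'); assumption. }
    assert (Y : rsum n (fun i => (d i - rho) * (W k i * W k i)) <= 0)
      by (rewrite <- X; apply (Squad (V k))).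
    assert (Y' := rsum_nonneg_eq0 n _ i (fun j Hj => Hterm k j Hj) Y Hi).
    assert (Hdi := Hd i Hi).
    apply Rmult_integral in Y'; destruct Y' as [Y'|Y']; [lra|].
    apply Rsqr_0_uniq; exact Y'. }
  assert (Hblock : forall i j, (i < n)%nat -> (j < n)%nat -> c i = c j -> Z i j = 1).
  { intros i j Hi Hj Hij; rewrite <- (Zdiag i Hi), !HV by assumption.
    apply rsum_ext; intros k Hk; f_equal.
    assert (X := HW k i Hk Hi); assert (Y := HW k j Hk Hj); unfold W in X, Y.
    rewrite Hij in X; lra. }
  rewrite HZs by assumption.
  destruct (Nat.eq_dec (c i0) (c j0)) as [Hij|Hij].
  { rewrite Hij, delta_refl; apply Hblock; assumption. }
  rewrite delta_neq by assumption.
  (* The entries of row [i0] inside its cluster already exhaust the row sum [K], so the nonnegative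
     ones outside vanish. *)
  assert (X : forall j, (j < n)%nat -> 0 <= Z i0 j - delta (c j) (c i0)).
  { intros j Hj; destruct (Nat.eq_dec (c j) (c i0)) as [He|He].
    - rewrite Hblock, He, delta_refl by auto; lra.
    - rewrite delta_neq by assumption; assert (Y := Zpos i0 j Hi0 Hj); lra. }
  assert (Y := rsum_nonneg_eq0 n _ j0 X).
  rewrite rsum_minus, Zrow, Hsize, (delta_neq (c j0)) in Y by auto.
  rewrite <- Y; [ring|lra|assumption].
Qed.

(** * Exponential moments in the block model *)

Lemma in_pairs (n i j : nat) : In (i, j) (pairs n) <-> (i < j)%nat /\ (j < n)%nat.
Proof.
  unfold pairs; rewrite in_flat_map; split.
  - intros (k & Hk & H); apply in_map_iff in H; destruct H as (i' & E & H).
    apply in_seq in Hk; apply in_seq in H; injection E as -> ->; lia.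
  - intros [H1 H2]; exists j; split; [apply in_seq; lia|].
    apply in_map_iff; exists i; split; [reflexivity|apply in_seq; lia].
Qed.

Lemma pairs_S (n : nat) : pairs (S n) = pairs n ++ map (fun i => (i, n)) (seq 0 n).
Proof.
  unfold pairs; rewrite seq_S, flat_map_app; simpl; rewrite app_nil_r; reflexivity.
Qed.

Lemma NoDup_pairs (n : nat) : NoDup (pairs n).
Proof.
  induction n as [|n IH]; [constructor|].
  rewrite pairs_S; apply NoDup_app; [exact IH| |].
  - apply NoDup_map_inv with (f := fst); rewrite map_map, map_id; apply seq_NoDup.
  - intros [i j] H1 H2; apply in_pairs in H1; apply in_map_iff in H2.
    destruct H2 as (i' & E & _); injection E as _ <-; lia.
Qed.

Lemma configs_support (ps : list (nat * nat)) (g : nat -> nat -> bool) (x y : nat) :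
  In g (configs ps) -> g x y = true -> In (x, y) ps.
Proof.
  revert g; induction ps as [|[i j] ps IH]; intros g; simpl.
  - intros [<-|[]]; discriminate.
  - intros Hg Hxy; apply in_flat_map in Hg; destruct Hg as (h & Hh & Hg).
    destruct Hg as [<-|[<-|[]]]; [right; apply (IH h); assumption|].
    destruct (Nat.eqb_spec x i) as [->|], (Nat.eqb_spec y j) as [->|]; simpl in Hxy;
      auto; right; apply (IH h); assumption.
Qed.

(** Independence of the edges, as a distributive law. By [NoDup], a configuration of the remaining
    pairs still has its default [false] at the new pair, so the two extensions give each value
    once. *)
Lemma configs_factorize (ps : list (nat * nat)) (F : nat * nat -> bool -> R) :
  NoDup ps ->
  lsum (configs ps) (fun g => lprod ps (fun e => F e (g (fst e) (snd e))))
  = lprod ps (fun e => F e true + F e false).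
Proof.
  induction ps as [|[i j] ps IH]; intros Hnd; [unfold lsum, lprod; simpl; ring|].
  inversion Hnd as [|? ? Hnotin Hnd']; subst.
  cbn [configs]; rewrite lsum_flat_map, lprod_cons, <- IH by assumption.
  rewrite <- lsum_scal; apply lsum_ext; intros g Hg.
  rewrite !lsum_cons; unfold lsum; simpl fold_right; rewrite !lprod_cons; cbn [fst snd].
  rewrite !Nat.eqb_refl; cbn [andb].
  assert (Hgij : g i j = false).
  { destruct (g i j) eqn:E; [|reflexivity].
    exfalso; apply Hnotin, (configs_support ps g); assumption. }
  rewrite Hgij.
  rewrite (lprod_ext ps
    (fun e => F e (if (Nat.eqb (fst e) i && Nat.eqb (snd e) j)%bool then true
                   else g (fst e) (snd e)))
    (fun e => F e (g (fst e) (snd e)))); [ring|].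
  intros [x y] Hxy; cbn [fst snd].
  destruct (Nat.eqb_spec x i) as [->|], (Nat.eqb_spec y j) as [->|]; try reflexivity.
  contradiction.
Qed.

Lemma dsum_pairs (n : nat) (G : nat -> nat -> R) :
  (forall i, G i i = 0) ->
  dsum n G = lsum (pairs n) (fun e => G (fst e) (snd e) + G (snd e) (fst e)).
Proof.
  intros HG; induction n as [|n IH]; [reflexivity|].
  rewrite dsum_S, pairs_S, lsum_app, lsum_map, IH, HG, lsum_plus.
  rewrite lsum_plus; cbn [fst snd]; rewrite !rsum_lsum; ring.
Qed.

(** * Expectations over edge configurations *)

Definition sbm_exp (n : nat) (p q : R) (Zs : nat -> nat -> R)
    (F : (nat -> nat -> R) -> R) : R :=
  lsum (configs (pairs n)) (fun g => weight n p q Zs g * F (adj g)).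

Lemma edge_prob_range (p q : R) (Zs : nat -> nat -> R) (i j : nat) :
  0 <= q <= p -> 0 <= edge_prob p q Zs i j <= p.
Proof. intros H; unfold edge_prob; destruct (Req_EM_T (Zs i j) 1); lra. Qed.

Lemma weight_nonneg (n : nat) (p q : R) (Zs : nat -> nat -> R) (g : nat -> nat -> bool) :
  0 <= q <= p -> p <= 1 -> 0 <= weight n p q Zs g.
Proof.
  intros Hq Hp.
  apply (lprod_le (pairs n)
    (fun e => if g (fst e) (snd e) then edge_prob p q Zs (fst e) (snd e)
              else 1 - edge_prob p q Zs (fst e) (snd e))
    (fun e => if g (fst e) (snd e) then edge_prob p q Zs (fst e) (snd e)
              else 1 - edge_prob p q Zs (fst e) (snd e))).
  intros e _; assert (H := edge_prob_range p q Zs (fst e) (snd e) Hq).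
  destruct (g (fst e) (snd e)); lra.
Qed.

Lemma one_plus_le_exp (x : R) : 1 + x <= exp x.
Proof.
  destruct (Req_dec x 0) as [->|Hx]; [rewrite exp_0; lra|].
  apply Rlt_le, exp_ineq1, Hx.
Qed.

Lemma adj_sym (g : nat -> nat -> bool) (i j : nat) : adj g i j = adj g j i.
Proof.
  unfold adj; destruct (Nat.ltb_spec i j), (Nat.ltb_spec j i); try reflexivity; lia.
Qed.

Lemma adj_diag (g : nat -> nat -> bool) (i : nat) : adj g i i = 0.
Proof. unfold adj; rewrite Nat.ltb_irrefl; reflexivity. Qed.

Lemma adj_nonneg (g : nat -> nat -> bool) (i j : nat) : 0 <= adj g i j.
Proof.
  unfold adj; destruct (Nat.ltb i j); [apply b2R_range|].
  destruct (Nat.ltb j i); [apply b2R_range|lra].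
Qed.

Lemma adj_lt (g : nat -> nat -> bool) (i j : nat) : (i < j)%nat -> adj g i j = b2R (g i j).
Proof. intros H; unfold adj; rewrite (proj2 (Nat.ltb_lt i j) H); reflexivity. Qed.

(** Each pair carries both coefficients [a i j] and [a j i], the factors separate, and a Bernoulli
    factor [1 + P * (exp x - 1)] is at most the Poisson one by [1 + y <= exp y]. *)
Lemma sbm_exp_exp_linear (n : nat) (p q : R) (Zs : nat -> nat -> R) (a : nat -> nat -> R) :
  0 <= q <= p -> p <= 1 ->
  sbm_exp n p q Zs (fun A => exp (dsum n (fun i j => a i j * A i j)))
  <= exp (lsum (pairs n) (fun e => edge_prob p q Zs (fst e) (snd e)
                                   * (exp (a (fst e) (snd e) + a (snd e) (fst e)) - 1))).
Proof.
  intros Hq Hp.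
  pose (F := fun (e : nat * nat) (b : bool) =>
    (if b then edge_prob p q Zs (fst e) (snd e) else 1 - edge_prob p q Zs (fst e) (snd e))
    * exp ((a (fst e) (snd e) + a (snd e) (fst e)) * b2R b)).
  transitivity (lsum (configs (pairs n))
                  (fun g => lprod (pairs n) (fun e => F e (g (fst e) (snd e))))).
  - right; apply lsum_ext; intros g _.
    rewrite dsum_pairs by (intros; rewrite adj_diag; ring).
    rewrite exp_lsum; unfold weight.
    assert (Hmul : forall (l : list (nat * nat)) u v,
      lprod l (fun e => u e * v e) = lprod l u * lprod l v).
    { intros l u v; induction l as [|e l IH]; [unfold lprod; simpl; ring|].
      rewrite !lprod_cons, IH; ring. }
    change (lprod (pairs n) (fun e => if g (fst e) (snd e) then edge_prob p q Zs (fst e) (snd e)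
              else 1 - edge_prob p q Zs (fst e) (snd e))
            * lprod (pairs n) (fun e => exp (a (fst e) (snd e) * adj g (fst e) (snd e)
                                             + a (snd e) (fst e) * adj g (snd e) (fst e)))
            = lprod (pairs n) (fun e => F e (g (fst e) (snd e)))).
    rewrite <- Hmul; apply lprod_ext; intros [i j] Hij; apply in_pairs in Hij.
    unfold F; cbn [fst snd]; rewrite (adj_sym g j i), adj_lt by lia.
    f_equal; f_equal; ring.
  - rewrite configs_factorize by apply NoDup_pairs.
    rewrite exp_lsum; apply lprod_le; intros e _.
    assert (He := edge_prob_range p q Zs (fst e) (snd e) Hq).
    set (x := a (fst e) (snd e) + a (snd e) (fst e)).
    unfold F; fold x; simpl b2R; rewrite Rmult_1_r, Rmult_0_r, exp_0.
    assert (Hx := exp_pos x).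
    assert (H1 := one_plus_le_exp (edge_prob p q Zs (fst e) (snd e) * (exp x - 1))).
    split; [|lra].
    apply Rplus_le_le_0_compat; apply Rmult_le_pos; lra.
Qed.

Lemma sbm_exp_le (n : nat) (p q : R) (Zs : nat -> nat -> R) (F G : (nat -> nat -> R) -> R) :
  0 <= q <= p -> p <= 1 -> (forall g, F (adj g) <= G (adj g)) ->
  sbm_exp n p q Zs F <= sbm_exp n p q Zs G.
Proof.
  intros Hq Hp H; apply lsum_le; intros g _.
  apply Rmult_le_compat_l; [apply weight_nonneg; assumption|apply H].
Qed.

Lemma sbm_exp_plus (n : nat) (p q : R) (Zs : nat -> nat -> R) (F G : (nat -> nat -> R) -> R) :
  sbm_exp n p q Zs (fun A => F A + G A) = sbm_exp n p q Zs F + sbm_exp n p q Zs G.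
Proof.
  unfold sbm_exp; rewrite <- lsum_plus; apply lsum_ext; intros; ring.
Qed.

Lemma sbm_exp_scal (n : nat) (p q : R) (Zs : nat -> nat -> R) (k : R) (F : (nat -> nat -> R) -> R) :
  sbm_exp n p q Zs (fun A => k * F A) = k * sbm_exp n p q Zs F.
Proof.
  unfold sbm_exp; rewrite <- lsum_scal; apply lsum_ext; intros; ring.
Qed.

Lemma sbm_exp_lsum (n : nat) (p q : R) (Zs : nat -> nat -> R) {X : Type} (l : list X)
    (F : X -> (nat -> nat -> R) -> R) :
  sbm_exp n p q Zs (fun A => lsum l (fun x => F x A))
  = lsum l (fun x => sbm_exp n p q Zs (F x)).
Proof.
  unfold sbm_exp; rewrite <- lsum_swap; apply lsum_ext; intros g _.
  symmetry; apply lsum_scal.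
Qed.

Lemma sbm_exp_one (n : nat) (p q : R) (Zs : nat -> nat -> R) :
  sbm_exp n p q Zs (fun _ => 1) = 1.
Proof.
  pose (F := fun (e : nat * nat) (b : bool) => if b then edge_prob p q Zs (fst e) (snd e)
                                               else 1 - edge_prob p q Zs (fst e) (snd e)).
  transitivity (lsum (configs (pairs n))
                  (fun g => lprod (pairs n) (fun e => F e (g (fst e) (snd e))))).
  - apply lsum_ext; intros; apply Rmult_1_r.
  - rewrite configs_factorize by apply NoDup_pairs.
    induction (pairs n) as [|e l IH]; [reflexivity|].
    rewrite lprod_cons, IH; unfold F; ring.
Qed.

(** Markov's inequality in pointwise form: the indicator of [E] plus [G] is at least 1 on every
    graph. *)
Lemma sbm_prob_lower (n : nat) (p q : R) (Zs : nat -> nat -> R)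
    (E : (nat -> nat -> R) -> Prop) (G : (nat -> nat -> R) -> R) :
  0 <= q <= p -> p <= 1 ->
  (forall g, 0 <= G (adj g)) -> (forall g, G (adj g) < 1 -> E (adj g)) ->
  1 - sbm_exp n p q Zs G <= sbm_prob n p q Zs E.
Proof.
  intros Hq Hp G0 HG.
  change (sbm_prob n p q Zs E) with (sbm_exp n p q Zs (fun A => indicator (E A))).
  assert (H : sbm_exp n p q Zs (fun _ => 1)
              <= sbm_exp n p q Zs (fun A => indicator (E A) + G A)).
  { apply sbm_exp_le; try assumption; intros g; unfold indicator.
    assert (X := G0 g); destruct (excluded_middle_informative (E (adj g))) as [|Hn]; [lra|].
    apply Rnot_gt_le; intros Hlt; apply Hn, HG; lra. }
  rewrite sbm_exp_one, sbm_exp_plus in H; lra.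
Qed.

(** Representatives of the functions from [{0, ..., n-1}] to [l], extended by [x0]. With pairs of
    booleans as values, a union bound over pairs of vertex sets becomes a finite sum. *)
Fixpoint vecs {X : Type} (l : list X) (x0 : X) (n : nat) : list (nat -> X) :=
  match n with
  | O => [fun _ => x0]
  | S m => flat_map (fun f => map (fun x i => if Nat.eqb i m then x else f i) l) (vecs l x0 m)
  end.

Lemma vecs_complete {X : Type} (l : list X) (x0 : X) (n : nat) (f : nat -> X) :
  (forall i, In (f i) l) ->
  exists g, In g (vecs l x0 n) /\ forall i, (i < n)%nat -> g i = f i.
Proof.
  intros Hf; induction n as [|n (g & Hg & Hgf)].
  - exists (fun _ => x0); split; [left; reflexivity|intros; lia].
  - exists (fun i => if Nat.eqb i n then f n else g i); split.
    + simpl; apply in_flat_map; exists g; split; [exact Hg|].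
      apply in_map_iff; exists (f n); split; [reflexivity|apply Hf].
    + intros i Hi; destruct (Nat.eqb_spec i n) as [->|]; [reflexivity|apply Hgf; lia].
Qed.

(** The distributive law again. With [phi = 0] it counts the functions; with [phi] proportional to
    an indicator it is a generating function by the size of a vertex set. *)
Lemma lsum_vecs_exp {X : Type} (l : list X) (x0 : X) (n : nat) (phi : X -> R) :
  lsum (vecs l x0 n) (fun f => exp (rsum n (fun i => phi (f i))))
  = lsum l (fun x => exp (phi x)) ^ n.
Proof.
  induction n as [|n IH]; [unfold lsum, rsum; simpl; rewrite exp_0; ring|].
  simpl vecs; rewrite lsum_flat_map; simpl pow; rewrite <- IH, <- lsum_scal.
  apply lsum_ext; intros f _; rewrite lsum_map, Rmult_comm, <- lsum_scal.
  apply lsum_ext; intros x _; rewrite rsum_S, Nat.eqb_refl, exp_plus; f_equal; f_equal.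
  apply rsum_ext; intros i Hi; rewrite (proj2 (Nat.eqb_neq i n)) by lia; reflexivity.
Qed.

(** Since [n = r * K], disjoint sets of size [K] leave no vertex over: [1 - N i] is nonnegative with
    sum zero. The partition is thus given by a label function, the form in which it is used from
    here on. *)
Lemma in_Znr_clusters (r K : nat) (Z : nat -> nat -> R) :
  in_Znr (r * K) r K Z ->
  exists c : nat -> nat,
    (forall i, (i < r * K)%nat -> (c i < r)%nat) /\
    (forall l, (l < r)%nat -> rsum (r * K) (fun i => delta (c i) l) = INR K) /\
    (forall i j, (i < r * K)%nat -> (j < r * K)%nat -> Z i j = delta (c i) (c j)).
Proof.
  set (n := (r * K)%nat); intros (xi & Hsize & Hdisj & HZ).
  assert (Hexcl : forall k k' i, (k < r)%nat -> (k' < r)%nat -> (i < n)%nat ->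
            xi k i = true -> xi k' i = true -> k = k').
  { intros k k' i Hk Hk' Hi H1 H2; destruct (Nat.eq_dec k k') as [|Hne]; [assumption|].
    assert (X : b2R (xi k i) * b2R (xi k' i) = 0).
    { apply (rsum_nonneg_eq0 n (fun i => b2R (xi k i) * b2R (xi k' i))); auto.
      - intros; apply Rmult_le_pos; apply b2R_range.
      - rewrite Hdisj by assumption; apply Rle_refl. }
    rewrite H1, H2 in X; simpl in X; lra. }
  pose (N := fun i => rsum r (fun k => b2R (xi k i))).
  assert (Hone : forall k i, (k < r)%nat -> (i < n)%nat -> xi k i = true ->
            forall k', (k' < r)%nat -> b2R (xi k' i) = delta k k').
  { intros k i Hk Hi H k' Hk'; destruct (Nat.eq_dec k k') as [<-|Hne];
      [rewrite delta_refl, H; reflexivity|].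
    rewrite delta_neq by assumption; destruct (xi k' i) eqn:E; [|reflexivity].
    exfalso; apply Hne, (Hexcl k k' i); assumption. }
  assert (HN1 : forall k i, (k < r)%nat -> (i < n)%nat -> xi k i = true -> N i = 1).
  { intros k i Hk Hi H; unfold N.
    rewrite (rsum_ext r _ (fun k' => delta k k' * 1))
      by (intros; rewrite (Hone k i) by assumption; ring).
    apply (rsum_delta r k (fun _ => 1) Hk). }
  assert (HN0 : forall i, (forall k, (k < r)%nat -> xi k i = false) -> N i = 0).
  { intros i H; apply rsum_eq0; intros k Hk; rewrite H by assumption; reflexivity. }
  (* The default [O] is not reached for [i < n] once every vertex is known to be covered. *)
  pose (c := fun i => match find (fun k => xi k i) (seq 0 r) with Some k => k | None => O end).
  assert (Hc : forall i, (i < n)%nat ->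
            ((c i < r)%nat /\ xi (c i) i = true) \/ (forall k, (k < r)%nat -> xi k i = false)).
  { intros i Hi; unfold c; destruct (find (fun k => xi k i) (seq 0 r)) as [k|] eqn:E.
    - left; apply find_some in E; destruct E as [E1 E2]; apply in_seq in E1.
      split; [lia|assumption].
    - right; intros k Hk; apply (find_none _ _ E); apply in_seq; lia. }
  assert (HNle : forall i, (i < n)%nat -> 0 <= 1 - N i).
  { intros i Hi; destruct (Hc i Hi) as [[H1 H2]|H];
      [rewrite (HN1 (c i)) by assumption; lra|rewrite HN0 by assumption; lra]. }
  assert (HNsum : rsum n (fun i => 1 - N i) <= 0).
  { rewrite rsum_minus, rsum_const; unfold N; rewrite rsum_swap.
    rewrite (rsum_ext r _ (fun _ => INR K)) by auto.
    rewrite rsum_const; unfold n; rewrite mult_INR; lra. }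
  assert (Hc' : forall i, (i < n)%nat -> (c i < r)%nat /\ xi (c i) i = true).
  { intros i Hi; destruct (Hc i Hi) as [H|H]; [assumption|].
    assert (X := rsum_nonneg_eq0 n _ i HNle HNsum Hi); cbv beta in X.
    rewrite HN0 in X by assumption; lra. }
  assert (Hxi : forall k i, (k < r)%nat -> (i < n)%nat -> b2R (xi k i) = delta (c i) k).
  { intros k i Hk Hi; destruct (Hc' i Hi); apply (Hone (c i) i); assumption. }
  exists c; split; [|split].
  - intros i Hi; apply Hc'; assumption.
  - intros l Hl; rewrite <- (Hsize l Hl); apply rsum_ext; intros i Hi; symmetry; auto.
  - intros i j Hi Hj; rewrite HZ by assumption.
    rewrite (rsum_ext r _ (fun k => delta (c i) k * delta (c j) k))
      by (intros; rewrite !Hxi by assumption; reflexivity).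
    rewrite (rsum_delta r (c i) (delta (c j))) by (apply Hc'; assumption).
    apply delta_sym.
Qed.

(** The expected adjacency matrix, expressed by labels so that symmetry and range hold at all
    indices. It has zero diagonal and agrees with [edge_prob] on [pairs n]. *)
Definition mean_adj (c : nat -> nat) (p q : R) (i j : nat) : R :=
  if Nat.eqb i j then 0 else if Nat.eqb (c i) (c j) then p else q.

Lemma mean_adj_sym (c : nat -> nat) (p q : R) (i j : nat) :
  mean_adj c p q i j = mean_adj c p q j i.
Proof. unfold mean_adj; rewrite (Nat.eqb_sym i j), (Nat.eqb_sym (c i)); reflexivity. Qed.

Lemma mean_adj_diag (c : nat -> nat) (p q : R) (i : nat) : mean_adj c p q i i = 0.
Proof. unfold mean_adj; rewrite Nat.eqb_refl; reflexivity. Qed.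

Lemma mean_adj_range (c : nat -> nat) (p q : R) (i j : nat) :
  0 <= q <= p -> 0 <= mean_adj c p q i j <= p.
Proof.
  intros H; unfold mean_adj; destruct (Nat.eqb i j); [lra|].
  destruct (Nat.eqb (c i) (c j)); lra.
Qed.

Lemma edge_prob_mean (n : nat) (c : nat -> nat) (p q : R) (Zs : nat -> nat -> R) (i j : nat) :
  (forall i j, (i < n)%nat -> (j < n)%nat -> Zs i j = delta (c i) (c j)) ->
  In (i, j) (pairs n) -> edge_prob p q Zs i j = mean_adj c p q i j.
Proof.
  intros HZ Hij; apply in_pairs in Hij; unfold edge_prob, mean_adj.
  rewrite HZ, (proj2 (Nat.eqb_neq i j)) by lia.
  unfold delta; destruct (Nat.eqb (c i) (c j)); simpl;
    destruct (Req_EM_T _ _); try reflexivity; lra.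
Qed.

(** * Moment generating functions of edge counts, cuts and rows *)

Lemma exp_mono (x y : R) : x <= y -> exp x <= exp y.
Proof. intros [H| ->]; [left; apply exp_increasing, H|right; reflexivity]. Qed.

(** From [1 - x <= exp (- x)] follows [exp x <= 1 / (1 - x)], and [(1 + x + 2 * x^2) * (1 - x) = 1 +
    x^2 * (1 - 2 * x)] is at least 1. *)
Lemma exp_le_quadratic (x : R) : x <= 1 / 2 -> exp x - 1 <= x + 2 * (x * x).
Proof.
  intros Hx.
  assert (H := one_plus_le_exp (- x)); rewrite exp_Ropp in H.
  assert (He := exp_pos x).
  assert (H1 : exp x * (1 - x) <= 1).
  { replace 1 with (exp x * / exp x) at 2 by (field; lra).
    apply Rmult_le_compat_l; lra. }
  apply Rmult_le_reg_r with (1 - x); [lra|].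
  assert (H2 : 0 <= x * x * (1 - 2 * x)) by (apply Rmult_le_pos; [apply Rle_0_sqr|lra]).
  nra.
Qed.

(** Uncentred, but valid for arbitrarily large [lambda]: this is the tool against rare dense spots.
    A pair lying in [S] and [T] both ways is counted twice, hence [2 * lambda]. *)
Lemma sbm_exp_edges (n : nat) (p q lambda : R) (Zs : nat -> nat -> R) (S T : nat -> bool) :
  0 <= q <= p -> p <= 1 -> 0 <= lambda ->
  sbm_exp n p q Zs
    (fun A => exp (lambda * dsum n (fun i j => b2R (S i) * b2R (T j) * A i j)))
  <= exp (p * exp (2 * lambda)
          * (rsum n (fun i => b2R (S i)) * rsum n (fun i => b2R (T i)))).
Proof.
  intros Hq Hp Hl.
  transitivity (sbm_exp n p q Zs
    (fun A => exp (dsum n (fun i j => lambda * (b2R (S i) * b2R (T j)) * A i j)))).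
  { right; apply lsum_ext; intros g _; f_equal; f_equal.
    rewrite <- dsum_scal; apply dsum_ext; intros; ring. }
  apply Rle_trans with (1 := sbm_exp_exp_linear n p q Zs _ Hq Hp).
  apply exp_mono.
  rewrite <- (dsum_mul n (fun i => b2R (S i)) (fun j => b2R (T j))), <- dsum_scal.
  pose (G := fun i j => (1 - delta i j) * (p * exp (2 * lambda) * (b2R (S i) * b2R (T j)))).
  assert (HE : 0 < exp (2 * lambda)) by apply exp_pos.
  assert (H0 : forall i j, 0 <= p * exp (2 * lambda) * (b2R (S i) * b2R (T j))).
  { intros i j; repeat apply Rmult_le_pos; try apply b2R_range; lra. }
  apply Rle_trans with (dsum n G).
  - rewrite (dsum_pairs n G) by (intros; unfold G; rewrite delta_refl; ring).
    apply lsum_le; intros [i j] Hij; apply in_pairs in Hij; unfold G; cbn [fst snd].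
    rewrite !delta_neq by lia.
    assert (He := edge_prob_range p q Zs i j Hq).
    assert (X1 : exp lambda <= exp (2 * lambda)) by (apply exp_mono; lra).
    assert (X2 : 1 <= exp (2 * lambda)) by (rewrite <- exp_0; apply exp_mono; lra).
    assert (X : forall u, 0 <= u - 1 -> edge_prob p q Zs i j * (u - 1) <= p * (u - 1))
      by (intros; apply Rmult_le_compat_r; lra).
    assert (X3 := X (exp (2 * lambda))). assert (X4 := X (exp lambda)).
    assert (X5 : 1 <= exp lambda) by (rewrite <- exp_0; apply exp_mono; lra).
    destruct (S i), (T j), (S j), (T i); simpl b2R;
      rewrite ?Rmult_1_r, ?Rmult_0_r, ?Rmult_0_l, ?Rplus_0_r, ?Rplus_0_l, ?exp_0;
      replace (lambda + lambda) with (2 * lambda) by ring; nra.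
  - apply dsum_le; intros i j _ _; unfold G.
    assert (X := H0 i j); assert (Y := b2R_range (Nat.eqb i j)); fold (delta i j) in Y.
    rewrite <- (Rmult_1_l (p * exp (2 * lambda) * (b2R (S i) * b2R (T j)))) at 2.
    apply Rmult_le_compat_r; lra.
Qed.

(** The linear terms cancel the mean, and the quadratic remainder is at most
    [2 * p * (2 * lambda)^2] for each of at most [n^2] pairs. The range of [lambda] keeps the
    coefficient of a doubly counted pair within [1 / 2], and both signs are needed for deviations on
    either side. *)
Lemma sbm_exp_cut (n : nat) (p q lambda : R) (c : nat -> nat) (Zs : nat -> nat -> R)
    (S T : nat -> bool) :
  0 <= q <= p -> p <= 1 -> - (1 / 4) <= lambda <= 1 / 4 ->
  (forall i j, (i < n)%nat -> (j < n)%nat -> Zs i j = delta (c i) (c j)) ->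
  sbm_exp n p q Zs (fun A =>
    exp (lambda * dsum n (fun i j => b2R (S i) * b2R (T j) * (A i j - mean_adj c p q i j))))
  <= exp (8 * (lambda * lambda) * p * (INR n * INR n)).
Proof.
  intros Hq Hp Hl HZ.
  pose (mu := lambda * dsum n (fun i j => b2R (S i) * b2R (T j) * mean_adj c p q i j)).
  pose (a := fun i j => lambda * (b2R (S i) * b2R (T j))).
  transitivity (exp (- mu) * sbm_exp n p q Zs
    (fun A => exp (dsum n (fun i j => a i j * A i j)))).
  { right; rewrite <- sbm_exp_scal; apply lsum_ext; intros g _; f_equal.
    rewrite <- exp_plus; f_equal; unfold mu.
    unfold a.
    rewrite (dsum_ext n (fun i j => b2R (S i) * b2R (T j) * (adj g i j - mean_adj c p q i j))
      (fun i j => b2R (S i) * b2R (T j) * adj g i j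
                  - b2R (S i) * b2R (T j) * mean_adj c p q i j)) by (intros; ring).
    rewrite (dsum_ext n (fun i j => lambda * (b2R (S i) * b2R (T j)) * adj g i j)
      (fun i j => lambda * (b2R (S i) * b2R (T j) * adj g i j))) by (intros; ring).
    rewrite dsum_minus, dsum_scal; ring. }
  apply Rle_trans with (exp (- mu) * exp (lsum (pairs n) (fun e =>
    edge_prob p q Zs (fst e) (snd e) * (exp (a (fst e) (snd e) + a (snd e) (fst e)) - 1)))).
  { apply Rmult_le_compat_l; [apply Rlt_le, exp_pos|].
    apply sbm_exp_exp_linear; assumption. }
  rewrite <- exp_plus.
  apply exp_mono.
  assert (Hmu : mu = lsum (pairs n) (fun e => edge_prob p q Zs (fst e) (snd e)
                              * (a (fst e) (snd e) + a (snd e) (fst e)))).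
  { unfold mu; rewrite <- dsum_scal, dsum_pairs by (intros; rewrite mean_adj_diag; ring).
    apply lsum_ext; intros [i j] Hij; cbn [fst snd].
    rewrite (edge_prob_mean n c p q Zs i j HZ Hij), (mean_adj_sym c p q j i).
    unfold a; ring. }
  apply Rle_trans with (lsum (pairs n) (fun _ => 8 * (lambda * lambda) * p)).
  - transitivity (-1 * mu + lsum (pairs n) (fun e =>
      edge_prob p q Zs (fst e) (snd e) * (exp (a (fst e) (snd e) + a (snd e) (fst e)) - 1)));
      [right; ring|].
    rewrite Hmu, <- lsum_scal, <- lsum_plus; apply lsum_le; intros [i j] _; cbn [fst snd].
    assert (He := edge_prob_range p q Zs i j Hq).
    set (x := a i j + a j i).
    assert (Hx : x <= 1 / 2 /\ x * x <= 4 * (lambda * lambda)).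
    { unfold x, a; destruct (S i), (T j), (S j), (T i); simpl; split; nra. }
    assert (X := exp_le_quadratic x (proj1 Hx)).
    apply Rle_trans with (edge_prob p q Zs i j * (2 * (x * x))).
    + assert (Y : edge_prob p q Zs i j * (exp x - 1 - x)
                  <= edge_prob p q Zs i j * (2 * (x * x)))
        by (apply Rmult_le_compat_l; lra).
      lra.
    + apply Rle_trans with (p * (2 * (x * x))).
      * apply Rmult_le_compat_r; [assert (Z := Rle_0_sqr x); unfold Rsqr in Z|]; lra.
      * apply Rle_trans with (p * (2 * (4 * (lambda * lambda)))); [|right; ring].
        apply Rmult_le_compat_l; lra.
  - set (k := 8 * (lambda * lambda) * p).
    assert (Hk : 0 <= k).
    { unfold k; apply Rmult_le_pos; [|lra].
      assert (Z := Rle_0_sqr lambda); unfold Rsqr in Z; lra. }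
    apply Rle_trans with (dsum n (fun i j => (1 - delta i j) * k)).
    + rewrite (dsum_pairs n) by (intros; rewrite delta_refl; ring).
      apply lsum_le; intros [i j] Hij; apply in_pairs in Hij; cbn [fst snd].
      rewrite !delta_neq by lia; lra.
    + apply Rle_trans with (dsum n (fun _ _ => k)).
      * apply dsum_le; intros i j _ _; assert (Y := b2R_range (Nat.eqb i j)).
        fold (delta i j) in Y; rewrite <- (Rmult_1_l k) at 2; apply Rmult_le_compat_r; lra.
      * unfold dsum; rewrite !rsum_const; right; ring.
Qed.

(** Only the pairs at [i] contribute, and the exact Poisson exponent is kept: the sharp constant of
    the recovery condition passes through here. *)
Lemma sbm_exp_row (n : nat) (p q : R) (c : nat -> nat) (Zs : nat -> nat -> R)
    (i : nat) (h : nat -> R) :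
  0 <= q <= p -> p <= 1 -> (i < n)%nat ->
  (forall i j, (i < n)%nat -> (j < n)%nat -> Zs i j = delta (c i) (c j)) ->
  sbm_exp n p q Zs (fun A => exp (rsum n (fun j => h j * A i j)))
  <= exp (rsum n (fun j => mean_adj c p q i j * (exp (h j) - 1))).
Proof.
  intros Hq Hp Hi HZ.
  transitivity (sbm_exp n p q Zs
    (fun A => exp (dsum n (fun x y => delta i x * h y * A x y)))).
  { right; apply lsum_ext; intros g _; f_equal; f_equal.
    rewrite (dsum_ext n _ (fun x y => delta i x * (h y * adj g x y))) by (intros; ring).
    rewrite (dsum_delta n i (fun x y => h y * adj g x y) Hi); reflexivity. }
  apply Rle_trans with (1 := sbm_exp_exp_linear n p q Zs _ Hq Hp); right; f_equal.
  rewrite <- (dsum_delta n i (fun x y => mean_adj c p q x y * (exp (h y) - 1)) Hi).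
  rewrite dsum_pairs by (intros; rewrite mean_adj_diag; ring).
  apply lsum_ext; intros [x y] Hxy; cbn [fst snd].
  rewrite (edge_prob_mean n c p q Zs x y HZ Hxy), (mean_adj_sym c p q y x).
  apply in_pairs in Hxy.
  destruct (Nat.eq_dec i x) as [<-|Hx]; [rewrite delta_refl, (delta_neq i y) by lia|
    destruct (Nat.eq_dec i y) as [<-|Hy]; [rewrite delta_refl, (delta_neq i x) by lia|
      rewrite !delta_neq by assumption]].
  - replace (1 * h y + 0 * h i) with (h y) by ring; ring.
  - replace (0 * h i + 1 * h x) with (h x) by ring; ring.
  - replace (0 * h y + 0 * h x) with 0 by ring; rewrite exp_0; ring.
Qed.

(** * Deterministic recovery *)

Fixpoint rmax (n : nat) (f : nat -> R) (x0 : R) : R :=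
  match n with O => x0 | S m => Rmax (rmax m f x0) (f m) end.

Lemma rmax_ge (n : nat) (f : nat -> R) (x0 : R) (i : nat) :
  (i < n)%nat -> f i <= rmax n f x0.
Proof.
  induction n as [|n IH]; intros Hi; [lia|]; simpl.
  destruct (Nat.eq_dec i n) as [->|]; [apply Rmax_r|].
  apply Rle_trans with (2 := Rmax_l _ _), IH; lia.
Qed.

Lemma rmax_lub_lt (n : nat) (f : nat -> R) (x0 y : R) :
  x0 < y -> (forall i, (i < n)%nat -> f i < y) -> rmax n f x0 < y.
Proof.
  intros H0; induction n as [|n IH]; intros H; simpl; [assumption|].
  apply Rmax_lub_lt; [apply IH; intros; apply H; lia|apply H; lia].
Qed.

(** Trading the maximum for a sum of excesses lets the sum over a cluster be exchanged with the sum
    over [l], after which each inner sum can be bounded by a cut deviation. *)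
Lemma rmax_le_excess (n : nat) (f : nat -> R) (x0 : R) :
  rmax n f x0 <= x0 + rsum n (fun l => Rmax 0 (f l - x0)).
Proof.
  induction n as [|n IH]; simpl; [unfold rsum; simpl; lra|].
  rewrite rsum_S; assert (X := Rmax_l 0 (f n - x0)); assert (Y := Rmax_r 0 (f n - x0)).
  assert (Z : 0 <= rsum n (fun l => Rmax 0 (f l - x0)))
    by (apply rsum_nonneg; intros; apply Rmax_l).
  apply Rmax_lub; lra.
Qed.

(** Adding [p] on the diagonal makes the mean additive in the sense of [additive_form_vanishes], so
    only [- p] times the squared norm survives. This permits passing from [A - P] to [A] in the
    spectral bound. *)
Lemma mean_form_nonpos (n r : nat) (c : nat -> nat) (p q : R) (w : nat -> R) :
  0 <= p -> (forall i, (i < n)%nat -> (c i < r)%nat) ->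
  (forall l, (l < r)%nat -> rsum n (fun i => delta (c i) l * w i) = 0) ->
  dsum n (fun i j => w i * w j * mean_adj c p q i j) <= 0.
Proof.
  intros Hp Hc Hw.
  pose (phi := fun i l => (q + (p - q) * delta (c i) l) / 2).
  rewrite (dsum_ext n _ (fun i j => w i * w j * (phi i (c j) + phi j (c i))
                                    - delta i j * (p * (w i * w j)))).
  - rewrite dsum_minus, (additive_form_vanishes n r) by assumption.
    assert (X : 0 <= dsum n (fun i j => delta i j * (p * (w i * w j)))); [|lra].
    apply rsum_nonneg; intros i Hi.
    rewrite (rsum_delta n i (fun j => p * (w i * w j)) Hi).
    apply Rmult_le_pos; [assumption|apply Rle_0_sqr].
  - intros i j _ _; unfold phi; rewrite (delta_sym (c j) (c i)); unfold mean_adj, delta.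
    destruct (Nat.eqb_spec i j) as [->|]; [rewrite Nat.eqb_refl; simpl; field|].
    destruct (Nat.eqb (c i) (c j)); simpl; field.
Qed.

(** The certificate is fed with [T = K * q], the mean number of neighbours in a foreign cluster, and
    with [m i] the maximum of [T] and the actual numbers. Individual maxima are controlled by the
    margin [D], their cluster averages by the cut norm; [D] must cover [3 * s] plus the spectral
    bound. *)
Lemma sdp_recovery (n r K : nat) (c : nat -> nat) (A Zs : nat -> nat -> R)
    (p q tau Delta h kappa B alpha s D : R) :
  (1 <= r)%nat -> (1 <= K)%nat ->
  (forall i, (i < n)%nat -> (c i < r)%nat) ->
  (forall l, (l < r)%nat -> rsum n (fun i => delta (c i) l) = INR K) ->
  (forall i j, (i < n)%nat -> (j < n)%nat -> Zs i j = delta (c i) (c j)) ->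
  (forall i j, 0 <= A i j) -> (forall i j, A i j = A j i) -> (forall i, A i i = 0) ->
  0 <= q <= p -> 0 < B -> 0 < alpha -> INR n / (B * B) <= h ->
  0 <= Delta -> 0 <= kappa -> 0 <= tau ->
  let e := fun i l => rsum n (fun j => delta (c j) l * A i j) in
  (forall S T : nat -> bool,
     - tau <= dsum n (fun i j => b2R (S i) * b2R (T j) * (A i j - mean_adj c p q i j)) <= tau) ->
  (forall i, (i < n)%nat -> rsum n (fun j => A i j) <= Delta) ->
  (forall S T : nat -> bool, (forall i, S i = true -> T i = true) ->
     rsum n (fun i => b2R (S i)) <= h ->
     dsum n (fun i j => b2R (S i) * b2R (T j) * A i j)
     <= kappa / 2 * rsum n (fun i => b2R (T i))) ->
  (forall i, (i < n)%nat -> INR K * q + D < e i (c i)) ->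
  (forall i l, (i < n)%nat -> (l < r)%nat -> l <> c i -> e i l + D < e i (c i)) ->
  INR r * tau <= INR K * s ->
  3 * s + (4 * B * B * tau / INR n + 2 * p * INR n / B + alpha * kappa + Delta / alpha) <= D ->
  sdp_unique_opt n K A Zs.
Proof.
  intros Hr HK Hc Hsize HZs A0 Asym Adiag Hq HB Ha Hh HDel Hkap Htau e
         Hcut Hdeg Hsp Hthr0 Hthr Hs HD.
  assert (Hr1 : 1 <= INR r) by (apply (le_INR 1); assumption).
  assert (HK1 : 1 <= INR K) by (apply (le_INR 1); assumption).
  set (T := INR K * q).
  pose (f := fun i l => if Nat.eqb l (c i) then T else e i l).
  pose (m := fun i => rmax r (f i) T).
  assert (Hrow : forall i k l, (l < r)%nat -> c i = k -> k <> l ->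
    rsum n (fun j => b2R (Nat.eqb (c j) l) * (A i j - mean_adj c p q i j)) = e i l - T).
  { intros i k l Hl Hk Hkl; unfold e, T; rewrite <- (Hsize l Hl), <- rsum_scal_r, <- rsum_minus.
    apply rsum_ext; intros j Hj; fold (delta (c j) l).
    destruct (Nat.eq_dec (c j) l) as [Hjl|Hjl]; [|rewrite delta_neq by assumption; ring].
    unfold mean_adj; rewrite (proj2 (Nat.eqb_neq i j)) by congruence.
    rewrite (proj2 (Nat.eqb_neq (c i) (c j))) by congruence; ring. }
  apply (sdp_dual_certificate n r K c A Zs m T s
    (4 * B * B * tau / INR n + 2 * p * INR n / B + alpha * kappa + Delta / alpha)); auto.
  - intros i l Hi Hl Hne; unfold m; fold (e i l).
    replace (e i l) with (f i l) by (unfold f; rewrite (proj2 (Nat.eqb_neq _ _) Hne); reflexivity).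
    apply rmax_ge; assumption.
  - intros k Hk.
    assert (Hexc : forall l, (l < r)%nat ->
      rsum n (fun j => delta (c j) k * Rmax 0 (f j l - T)) <= tau).
    { intros l Hl; destruct (Nat.eq_dec l k) as [->|Hne].
      - rewrite rsum_eq0; [assumption|]; intros j Hj.
        destruct (Nat.eq_dec (c j) k) as [Hjk|Hjk]; [|rewrite delta_neq by assumption; ring].
        unfold f; rewrite Hjk, Nat.eqb_refl, Rminus_diag, Rmax_left by lra; ring.
      (* These are the vertices of cluster [k] with an excess towards [l]: the sum of positive parts
         is the cut deviation of this set against cluster [l]. *)
      - pose (S := fun j => andb (Nat.eqb (c j) k) (sgn_pos (e j l - T))).
        apply Rle_trans with (2 := proj2 (Hcut S (fun j => Nat.eqb (c j) l))).
        right; apply rsum_ext; intros i Hi.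
        rewrite (rsum_ext n _ (fun j => b2R (S i)
          * (b2R (Nat.eqb (c j) l) * (A i j - mean_adj c p q i j)))) by (intros; ring).
        rewrite rsum_scal; unfold S, f, delta, sgn_pos.
        destruct (Nat.eqb_spec (c i) k) as [Hik|Hik]; simpl; [|ring].
        rewrite (Hrow i k l), (proj2 (Nat.eqb_neq l (c i))) by congruence.
        destruct (Rle_dec 0 (e i l - T)); simpl;
          [rewrite Rmax_right by assumption|rewrite Rmax_left by lra]; ring. }
    apply Rle_trans with (rsum n (fun j => T * delta (c j) k
      + rsum r (fun l => delta (c j) k * Rmax 0 (f j l - T)))).
    + apply rsum_le; intros j Hj; rewrite rsum_scal.
      assert (X := rmax_le_excess r (f j) T); fold (m j) in X.
      assert (Y := b2R_range (Nat.eqb (c j) k)); fold (delta (c j) k) in Y.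
      rewrite (Rmult_comm T), <- Rmult_plus_distr_l; apply Rmult_le_compat_l; lra.
    + rewrite rsum_plus, rsum_scal, Hsize, rsum_swap by assumption.
      apply Rle_trans with (T * INR K + rsum r (fun _ => tau)).
      * apply Rplus_le_compat_l, rsum_le; intros; apply Hexc; assumption.
      * rewrite rsum_const; lra.
  - intros k l Hk Hl Hkl.
    assert (X := proj1 (Hcut (fun i => Nat.eqb (c i) k) (fun j => Nat.eqb (c j) l))).
    assert (Y : dsum n (fun i j => b2R (Nat.eqb (c i) k) * b2R (Nat.eqb (c j) l)
                                   * (A i j - mean_adj c p q i j))
                = rsum n (fun i => delta (c i) k * e i l) - T * INR K).
    { rewrite <- (Hsize k Hk), <- rsum_scal, <- rsum_minus.
      apply rsum_ext; intros i Hi; fold (delta (c i) k).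
      rewrite (rsum_ext n _ (fun j => delta (c i) k
        * (b2R (Nat.eqb (c j) l) * (A i j - mean_adj c p q i j)))) by (intros; ring).
      rewrite rsum_scal; destruct (Nat.eq_dec (c i) k) as [Hik|Hik];
        [rewrite (Hrow i k l) by assumption; ring|rewrite delta_neq by assumption; ring]. }
    cbv beta in X; rewrite Y in X; change (INR K * (T - 2 * s) <= rsum n (fun i => delta (c i) k * e i l)).
    assert (Z : tau <= INR r * tau)
      by (rewrite <- (Rmult_1_l tau) at 1; apply Rmult_le_compat_r; assumption).
    lra.
  - intros i Hi; fold (e i (c i)).
    assert (X : m i < e i (c i) - D).
    (* The floor [T] of the maximum calls for the margin over [K * q], the other entries for the
       margins over the foreign counts. *)
    { apply rmax_lub_lt; [assert (X := Hthr0 i Hi); unfold T; lra|].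
      intros l Hl; unfold f; destruct (Nat.eqb_spec l (c i)) as [->|Hne].
      - assert (X := Hthr0 i Hi); unfold T; lra.
      - assert (X := Hthr i l Hi Hl Hne); lra. }
    lra.
  - intros w Hw.
    assert (X := spectral_bound n A (mean_adj c p q) tau Delta h kappa B alpha p w
      HB Ha Hh HDel Hkap Htau A0 Asym Adiag (Rle_trans _ _ _ (proj1 Hq) (proj2 Hq))
      (fun i j => mean_adj_range c p q i j Hq) Hcut Hdeg Hsp).
    assert (Y := mean_form_nonpos n r c p q w ltac:(lra) Hc Hw).
    rewrite (dsum_ext n _ (fun i j => w i * w j * A i j - w i * w j * mean_adj c p q i j)) in X
      by (intros; ring).
    rewrite dsum_minus in X; lra.
Qed.

(** * Failure probabilities *)

(** The own cluster offers [K - 1] possible neighbours instead of [K]; the missing factor costs at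
    most [p] in the exponent. The comparison with the constant [K * q] obeys the same bound because
    [theta <= exp theta - 1]. *)
Lemma sbm_exp_threshold (n r K : nat) (p q theta : R) (c : nat -> nat) (Zs : nat -> nat -> R)
    (i l : nat) :
  0 <= q <= p -> p <= 1 -> 0 <= theta -> (i < n)%nat ->
  (forall i, (i < n)%nat -> (c i < r)%nat) ->
  (forall l, (l < r)%nat -> rsum n (fun i => delta (c i) l) = INR K) ->
  (forall i j, (i < n)%nat -> (j < n)%nat -> Zs i j = delta (c i) (c j)) ->
  let bound := exp (p + INR K * (q * (exp theta - 1) + p * (exp (- theta) - 1))) in
  sbm_exp n p q Zs (fun A =>
    exp (theta * (INR K * q - rsum n (fun j => delta (c j) (c i) * A i j)))) <= bound /\
  ((l < r)%nat -> l <> c i ->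
   sbm_exp n p q Zs (fun A =>
     exp (theta * (rsum n (fun j => delta (c j) l * A i j)
                   - rsum n (fun j => delta (c j) (c i) * A i j)))) <= bound).
Proof.
  intros Hq Hp Ht Hi Hc Hsize HZ bound.
  set (v := p * (exp (- theta) - 1)).
  assert (Hv : - v <= p).
  { unfold v; assert (X := exp_pos (- theta)).
    assert (0 <= p * exp (- theta)) by (apply Rmult_le_pos; lra); lra. }
  split.
  - pose (h := fun j => - theta * delta (c j) (c i)).
    transitivity (exp (theta * (INR K * q))
      * sbm_exp n p q Zs (fun A => exp (rsum n (fun j => h j * A i j)))).
    { right; rewrite <- sbm_exp_scal; apply lsum_ext; intros g _; f_equal.
      rewrite <- exp_plus; f_equal; unfold h.
      rewrite (rsum_ext n (fun j => - theta * _ * _)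
        (fun j => - theta * (delta (c j) (c i) * adj g i j))) by (intros; ring).
      rewrite rsum_scal; ring. }
    apply Rle_trans with (exp (theta * (INR K * q))
      * exp (rsum n (fun j => mean_adj c p q i j * (exp (h j) - 1)))).
    { apply Rmult_le_compat_l; [apply Rlt_le, exp_pos|].
      apply sbm_exp_row; assumption. }
    rewrite <- exp_plus; apply exp_mono.
    rewrite (rsum_ext n _ (fun j => v * delta (c j) (c i) - delta i j * v)).
    2:{ intros j Hj; unfold h, v, mean_adj; destruct (Nat.eqb_spec i j) as [<-|Hij].
        - rewrite !delta_refl; ring.
        - rewrite (delta_neq i j) by assumption; unfold delta; rewrite (Nat.eqb_sym (c j)).
          destruct (Nat.eqb (c i) (c j)); simpl; rewrite ?Rmult_1_r, ?Rmult_0_r, ?exp_0; ring. }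
    rewrite rsum_minus, rsum_scal, Hsize, (rsum_delta n i (fun _ => v)) by auto.
    assert (X := one_plus_le_exp theta).
    assert (Y : INR K * q * theta <= INR K * q * (exp theta - 1)).
    { apply Rmult_le_compat_l; [apply Rmult_le_pos; [apply pos_INR|]|]; lra. }
    fold v; lra.
  - intros Hl Hne.
    pose (h := fun j => theta * (delta (c j) l - delta (c j) (c i))).
    transitivity (sbm_exp n p q Zs (fun A => exp (rsum n (fun j => h j * A i j)))).
    { right; apply lsum_ext; intros g _; f_equal; f_equal; unfold h.
      rewrite <- rsum_minus, <- rsum_scal; apply rsum_ext; intros; ring. }
    apply Rle_trans with (1 := sbm_exp_row n p q c Zs i h Hq Hp Hi HZ); apply exp_mono.
    rewrite (rsum_ext n _ (fun j => q * (exp theta - 1) * delta (c j) l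
                                    + v * delta (c j) (c i) - delta i j * v)).
    2:{ intros j Hj; unfold h, v, mean_adj; destruct (Nat.eqb_spec i j) as [<-|Hij].
        - rewrite !delta_refl, delta_neq by auto; ring.
        - rewrite (delta_neq i j) by assumption.
          destruct (Nat.eq_dec (c j) l) as [->|Hjl].
          + rewrite (proj2 (Nat.eqb_neq (c i) l)), delta_refl, (delta_neq l (c i)) by auto.
            replace (theta * (1 - 0)) with theta by ring; ring.
          + rewrite (delta_neq (c j) l) by assumption.
            unfold delta; rewrite (Nat.eqb_sym (c j)).
            destruct (Nat.eqb (c i) (c j)); simpl.
            * replace (theta * (0 - 1)) with (- theta) by ring; ring.
            * replace (theta * (0 - 0)) with 0 by ring; rewrite exp_0; ring. }
    rewrite rsum_minus, rsum_plus, !rsum_scal, !Hsize, (rsum_delta n i (fun _ => v)) by auto.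
    fold v; lra.
Qed.

(** * Exponential majorants of the four failure events *)

Lemma exp_lt_1_inv (x : R) : exp x < 1 -> x < 0.
Proof. intros H; apply exp_lt_inv; rewrite exp_0; exact H. Qed.

(** A union bound in integrated form: one Chernoff term for each pair of vertex sets and each sign.
    A total below 1 makes every exponent negative, which is the cut bound. *)
Definition cut_excess (n : nat) (p q : R) (c : nat -> nat) (lambda tau : R)
    (A : nat -> nat -> R) : R :=
  lsum (vecs [(true, true); (true, false); (false, true); (false, false)] (false, false) n)
    (fun f =>
       let D := dsum n (fun i j => b2R (fst (f i)) * b2R (snd (f j))
                                   * (A i j - mean_adj c p q i j)) in
       exp (- (lambda * tau)) * exp (lambda * D) + exp (- (lambda * tau)) * exp (- lambda * D)).

Lemma cut_excess_nonneg n p q c lambda tau A : 0 <= cut_excess n p q c lambda tau A.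
Proof.
  apply lsum_nonneg; intros f _; cbv zeta; rewrite <- !exp_plus.
  apply Rplus_le_le_0_compat; apply Rlt_le, exp_pos.
Qed.

Lemma cut_excess_lt_1 n p q c lambda tau A :
  0 < lambda -> cut_excess n p q c lambda tau A < 1 ->
  forall S T : nat -> bool,
    - tau <= dsum n (fun i j => b2R (S i) * b2R (T j) * (A i j - mean_adj c p q i j)) <= tau.
Proof.
  intros Hl Hlt S T.
  destruct (vecs_complete [(true, true); (true, false); (false, true); (false, false)]
              (false, false) n (fun i => (S i, T i))) as (f & Hf & HfST).
  { intros i; destruct (S i), (T i); simpl; auto. }
  rewrite (dsum_ext n _ (fun i j => b2R (fst (f i)) * b2R (snd (f j))
                                    * (A i j - mean_adj c p q i j)))
    by (intros; rewrite !HfST by assumption; reflexivity).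
  set (D := dsum n _).
  assert (X : exp (- (lambda * tau)) * exp (lambda * D)
              + exp (- (lambda * tau)) * exp (- lambda * D) < 1).
  { apply Rle_lt_trans with (2 := Hlt).
    apply (lsum_term_le _ (fun f =>
       let D := dsum n (fun i j => b2R (fst (f i)) * b2R (snd (f j))
                                   * (A i j - mean_adj c p q i j)) in
       exp (- (lambda * tau)) * exp (lambda * D)
       + exp (- (lambda * tau)) * exp (- lambda * D)) f); [|exact Hf].
    intros g _; cbv zeta; rewrite <- !exp_plus.
    apply Rplus_le_le_0_compat; apply Rlt_le, exp_pos. }
  rewrite <- !exp_plus in X.
  assert (P1 := exp_pos (- (lambda * tau) + lambda * D)).
  assert (P2 := exp_pos (- (lambda * tau) + - lambda * D)).
  assert (X1 : - (lambda * tau) + lambda * D < 0) by (apply exp_lt_1_inv; lra).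
  assert (X2 : - (lambda * tau) + - lambda * D < 0) by (apply exp_lt_1_inv; lra).
  split; apply Rmult_le_reg_l with lambda; lra.
Qed.

Lemma cut_excess_mean n p q c lambda tau Zs :
  0 <= q <= p -> p <= 1 -> 0 <= lambda <= 1 / 4 ->
  (forall i j, (i < n)%nat -> (j < n)%nat -> Zs i j = delta (c i) (c j)) ->
  sbm_exp n p q Zs (cut_excess n p q c lambda tau)
  <= 4 ^ n * (2 * exp (8 * (lambda * lambda) * p * (INR n * INR n) - lambda * tau)).
Proof.
  intros Hq Hp Hl HZ; unfold cut_excess; rewrite sbm_exp_lsum.
  set (k := 2 * exp _).
  set (V := vecs _ _ n).
  assert (Hcard : lsum V (fun f => exp (rsum n (fun i => (fun _ => 0) (f i)))) = 4 ^ n).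
  { unfold V; etransitivity; [apply (lsum_vecs_exp _ _ n (fun _ => 0))|].
    f_equal; unfold lsum; simpl; rewrite exp_0; ring. }
  rewrite <- Hcard, (Rmult_comm (lsum V _) k), <- lsum_scal; apply lsum_le; intros f _.
  rewrite rsum_zero, exp_0, Rmult_1_r; cbv zeta.
  rewrite sbm_exp_plus, !sbm_exp_scal.
  assert (X1 := sbm_exp_cut n p q lambda c Zs (fun i => fst (f i)) (fun i => snd (f i))
                  Hq Hp ltac:(lra) HZ).
  assert (X2 := sbm_exp_cut n p q (- lambda) c Zs (fun i => fst (f i)) (fun i => snd (f i))
                  Hq Hp ltac:(lra) HZ).
  cbv beta in X1, X2.
  replace (- lambda * - lambda) with (lambda * lambda) in X2 by ring.
  assert (E := exp_pos (- (lambda * tau))).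
  apply Rmult_le_compat_l with (r := exp (- (lambda * tau))) in X1; [|lra].
  apply Rmult_le_compat_l with (r := exp (- (lambda * tau))) in X2; [|lra].
  unfold k.
  replace (8 * (lambda * lambda) * p * (INR n * INR n) - lambda * tau)
    with (- (lambda * tau) + 8 * (lambda * lambda) * p * (INR n * INR n)) by ring.
  rewrite exp_plus; lra.
Qed.

(** The degree of [v] is written as a cut between [{v}] and everything, so that [sbm_exp_edges]
    applies with parameter 1. *)
Definition degree_excess (n : nat) (Delta : R) (A : nat -> nat -> R) : R :=
  lsum (seq 0 n) (fun v => exp (- Delta)
    * exp (1 * dsum n (fun i j => b2R (Nat.eqb v i) * b2R true * A i j))).

Lemma degree_excess_nonneg n Delta A : 0 <= degree_excess n Delta A.
Proof. apply lsum_nonneg; intros; rewrite <- exp_plus; apply Rlt_le, exp_pos. Qed.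

Lemma degree_excess_lt_1 n Delta A :
  degree_excess n Delta A < 1 ->
  forall i, (i < n)%nat -> rsum n (fun j => A i j) <= Delta.
Proof.
  intros Hlt i Hi.
  assert (X : exp (- Delta) * exp (1 * dsum n (fun x j => b2R (Nat.eqb i x) * b2R true * A x j)) < 1).
  { apply Rle_lt_trans with (2 := Hlt).
    apply (lsum_term_le (seq 0 n) (fun v => exp (- Delta)
      * exp (1 * dsum n (fun i j => b2R (Nat.eqb v i) * b2R true * A i j)))); [|apply in_seq; lia].
    intros; rewrite <- exp_plus; apply Rlt_le, exp_pos. }
  rewrite <- exp_plus in X; apply exp_lt_1_inv in X.
  rewrite (dsum_ext n _ (fun x j => delta i x * A x j)), dsum_delta in X
    by (intros; try unfold delta; simpl; auto; ring); lra.
Qed.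

Lemma degree_excess_mean n p q Zs Delta :
  0 <= q <= p -> p <= 1 ->
  sbm_exp n p q Zs (degree_excess n Delta) <= INR n * exp (p * exp 2 * INR n - Delta).
Proof.
  intros Hq Hp; unfold degree_excess; rewrite sbm_exp_lsum.
  rewrite <- (rsum_const n), rsum_lsum; apply lsum_le; intros v Hv; apply in_seq in Hv.
  rewrite sbm_exp_scal.
  assert (X := sbm_exp_edges n p q 1 Zs (Nat.eqb v) (fun _ => true) Hq Hp ltac:(lra)).
  rewrite (rsum_ext n (fun i => b2R (Nat.eqb v i)) (fun i => delta v i * 1)) in X
    by (intros; unfold delta; ring).
  rewrite (rsum_delta n v (fun _ => 1)) in X by lia; simpl b2R in X.
  rewrite rsum_const, Rmult_1_l, !Rmult_1_r in X.
  unfold Rminus; rewrite Rplus_comm, exp_plus.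
  apply Rmult_le_compat_l; [apply Rlt_le, exp_pos|exact X].
Qed.

(** Three states per vertex encode [S] inside [T]. Empty [T] gets weight 0 since its term would
    otherwise equal 1 and the total could never fall below 1. *)
Definition sparse_excess (n : nat) (h kappa lambda : R) (A : nat -> nat -> R) : R :=
  lsum (vecs [(true, true); (false, true); (false, false)] (false, false) n)
    (fun f =>
       (if Rle_dec (rsum n (fun i => b2R (fst (f i)))) h then
          if Rle_dec 1 (rsum n (fun i => b2R (snd (f i)))) then
            exp (- (lambda * (kappa / 2 * rsum n (fun i => b2R (snd (f i))))))
          else 0
        else 0)
       * exp (lambda * dsum n (fun i j => b2R (fst (f i)) * b2R (snd (f j)) * A i j))).

Lemma sparse_excess_term_nonneg (u v k x : R) :
  0 <= (if Rle_dec u k then if Rle_dec 1 v then exp x else 0 else 0).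
Proof.
  destruct (Rle_dec u k); [|lra]; destruct (Rle_dec 1 v); [apply Rlt_le, exp_pos|lra].
Qed.

Lemma sparse_excess_nonneg n h kappa lambda A : 0 <= sparse_excess n h kappa lambda A.
Proof.
  apply lsum_nonneg; intros; apply Rmult_le_pos;
    [apply sparse_excess_term_nonneg|apply Rlt_le, exp_pos].
Qed.

Lemma sparse_excess_lt_1 n h kappa lambda A :
  0 < lambda -> sparse_excess n h kappa lambda A < 1 ->
  forall S T : nat -> bool, (forall i, S i = true -> T i = true) ->
    rsum n (fun i => b2R (S i)) <= h ->
    dsum n (fun i j => b2R (S i) * b2R (T j) * A i j)
    <= kappa / 2 * rsum n (fun i => b2R (T i)).
Proof.
  intros Hl Hlt S T HST Hh.
  destruct (Rle_lt_dec 1 (rsum n (fun i => b2R (T i)))) as [HT|HT].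
  - destruct (vecs_complete [(true, true); (false, true); (false, false)]
                (false, false) n (fun i => (S i, T i))) as (f & Hf & HfST).
    { intros i; specialize (HST i); destruct (S i), (T i); simpl; auto.
      specialize (HST eq_refl); discriminate. }
    assert (ES : rsum n (fun i => b2R (fst (f i))) = rsum n (fun i => b2R (S i)))
      by (apply rsum_ext; intros; rewrite HfST by assumption; reflexivity).
    assert (ET : rsum n (fun i => b2R (snd (f i))) = rsum n (fun i => b2R (T i)))
      by (apply rsum_ext; intros; rewrite HfST by assumption; reflexivity).
    rewrite (dsum_ext n _ (fun i j => b2R (fst (f i)) * b2R (snd (f j)) * A i j))
      by (intros; rewrite !HfST by assumption; reflexivity).
    assert (X := lsum_term_le _ _ f (fun g _ => Rmult_le_pos _ _
      (sparse_excess_term_nonneg (rsum n (fun i => b2R (fst (g i))))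
         (rsum n (fun i => b2R (snd (g i)))) h
         (- (lambda * (kappa / 2 * rsum n (fun i => b2R (snd (g i)))))))
      (Rlt_le _ _ (exp_pos (lambda * dsum n
         (fun i j => b2R (fst (g i)) * b2R (snd (g j)) * A i j))))) Hf).
    assert (Y := Rle_lt_trans _ _ _ X Hlt); clear X; cbv beta in Y.
    rewrite ES, ET in Y.
    destruct (Rle_dec _ h) as [_|]; [|contradiction].
    destruct (Rle_dec 1 _) as [_|]; [|contradiction].
    rewrite <- exp_plus in Y; apply exp_lt_1_inv in Y.
    apply Rmult_le_reg_l with lambda; lra.
  - assert (HT0 : forall i, (i < n)%nat -> b2R (T i) = 0).
    { intros i Hi; assert (X := rsum_term_le n (fun i => b2R (T i)) i
        (fun j _ => proj1 (b2R_range (T j))) Hi); cbv beta in X.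
      destruct (T i); simpl in *; [lra|reflexivity]. }
    rewrite (rsum_eq0 n _ HT0), (dsum_ext n _ (fun _ _ => 0 * 0))
      by (intros; rewrite HT0 by assumption; ring).
    rewrite dsum_scal; lra.
Qed.

(** The exponent is at most [- 4 * L] per vertex of [T], hence, [T] being nonempty, at most
    [- 2 * L] once plus [- 2 * L] per vertex. The first part is the prefactor; the second sums to a
    generating function where a vertex of [T] has two states of weight [exp (- (2 * L))]. *)
Lemma sparse_excess_mean n p q Zs h kappa lambda L :
  0 <= q <= p -> p <= 1 -> 0 <= lambda -> 0 <= L ->
  p * exp (2 * lambda) * h - lambda * (kappa / 2) <= - (4 * L) ->
  sbm_exp n p q Zs (sparse_excess n h kappa lambda)
  <= exp (- (2 * L)) * (1 + 2 * exp (- (2 * L))) ^ n.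
Proof.
  intros Hq Hp Hl HL Hexp; unfold sparse_excess; rewrite sbm_exp_lsum.
  set (V := vecs _ _ n).
  assert (Hsum : lsum V (fun f => exp (rsum n (fun i => (fun x => - (2 * L) * b2R (snd x)) (f i))))
                 = (1 + 2 * exp (- (2 * L))) ^ n).
  { unfold V; etransitivity;
      [apply (lsum_vecs_exp _ _ n (fun x => - (2 * L) * b2R (snd x)))|].
    f_equal; unfold lsum; simpl.
    rewrite !Rmult_1_r, Rmult_0_r, exp_0; ring. }
  rewrite <- Hsum, <- lsum_scal; apply lsum_le; intros f _; rewrite sbm_exp_scal.
  rewrite rsum_scal, <- exp_plus.
  assert (X := sbm_exp_edges n p q lambda Zs (fun i => fst (f i)) (fun i => snd (f i)) Hq Hp Hl).
  cbv beta in X.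
  set (s := rsum n (fun i => b2R (fst (f i)))) in *.
  set (t := rsum n (fun i => b2R (snd (f i)))) in *.
  assert (P := exp_pos (- (2 * L) + - (2 * L) * t)).
  destruct (Rle_dec s h) as [Hs|]; [|lra].
  destruct (Rle_dec 1 t) as [Ht|]; [|lra].
  apply Rle_trans with (exp (- (lambda * (kappa / 2 * t))) * exp (p * exp (2 * lambda) * (s * t))).
  { apply Rmult_le_compat_l; [apply Rlt_le, exp_pos|exact X]. }
  rewrite <- exp_plus; apply exp_mono.
  assert (Hpe : 0 <= p * exp (2 * lambda))
    by (apply Rmult_le_pos; [lra|apply Rlt_le, exp_pos]).
  assert (Y1 : p * exp (2 * lambda) * (s * t) <= p * exp (2 * lambda) * (h * t)).
  { apply Rmult_le_compat_l; [exact Hpe|apply Rmult_le_compat_r; lra]. }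
  assert (Y2 : (p * exp (2 * lambda) * h - lambda * (kappa / 2)) * t <= - (4 * L) * t)
    by (apply Rmult_le_compat_r; lra).
  assert (Y3 : L * 1 <= L * t) by (apply Rmult_le_compat_l; lra).
  lra.
Qed.

(** The factor [1 - delta l (c i)] switches off the own cluster, whose term would be
    [exp (theta * D)], not below 1 for a positive margin. *)
Definition threshold_excess (n r K : nat) (q : R) (c : nat -> nat) (theta D : R)
    (A : nat -> nat -> R) : R :=
  lsum (seq 0 n) (fun i =>
    exp (theta * D)
      * exp (theta * (INR K * q - rsum n (fun j => delta (c j) (c i) * A i j)))
    + lsum (seq 0 r) (fun l =>
        (1 - delta l (c i)) * exp (theta * D)
        * exp (theta * (rsum n (fun j => delta (c j) l * A i j)
                        - rsum n (fun j => delta (c j) (c i) * A i j))))).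

Lemma threshold_excess_inner_nonneg (r k : nat) (x : R) (y : nat -> R) :
  forall l, In l (seq 0 r) -> 0 <= (1 - delta l k) * exp x * exp (y l).
Proof.
  intros l _; assert (Y := b2R_range (Nat.eqb l k)); fold (delta l k) in Y.
  apply Rmult_le_pos; [apply Rmult_le_pos|]; try (apply Rlt_le, exp_pos); lra.
Qed.

Lemma threshold_excess_term_nonneg (n r K : nat) (q : R) (c : nat -> nat) (theta D : R)
    (A : nat -> nat -> R) (i : nat) :
  0 <= exp (theta * D)
      * exp (theta * (INR K * q - rsum n (fun j => delta (c j) (c i) * A i j)))
    + lsum (seq 0 r) (fun l =>
        (1 - delta l (c i)) * exp (theta * D)
        * exp (theta * (rsum n (fun j => delta (c j) l * A i j)
                        - rsum n (fun j => delta (c j) (c i) * A i j)))).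
Proof.
  apply Rplus_le_le_0_compat; [rewrite <- exp_plus; apply Rlt_le, exp_pos|].
  apply lsum_nonneg; intros l Hl.
  apply (threshold_excess_inner_nonneg r (c i) (theta * D)
    (fun l => theta * (rsum n (fun j => delta (c j) l * A i j)
                       - rsum n (fun j => delta (c j) (c i) * A i j))) l Hl).
Qed.

Lemma threshold_excess_nonneg n r K q c theta D A :
  0 <= threshold_excess n r K q c theta D A.
Proof. apply lsum_nonneg; intros; apply threshold_excess_term_nonneg. Qed.

Lemma threshold_excess_lt_1 n r K q c theta D A :
  0 < theta -> threshold_excess n r K q c theta D A < 1 ->
  let e := fun i l => rsum n (fun j => delta (c j) l * A i j) in
  (forall i, (i < n)%nat -> INR K * q + D < e i (c i)) /\
  (forall i l, (i < n)%nat -> (l < r)%nat -> l <> c i -> e i l + D < e i (c i)).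
Proof.
  intros Ht Hlt e.
  assert (H : forall i, (i < n)%nat ->
    exp (theta * D) * exp (theta * (INR K * q - e i (c i)))
    + lsum (seq 0 r) (fun l => (1 - delta l (c i)) * exp (theta * D)
        * exp (theta * (e i l - e i (c i)))) < 1).
  { intros i Hi; apply Rle_lt_trans with (2 := Hlt).
    apply (lsum_term_le (seq 0 n) (fun i => exp (theta * D)
      * exp (theta * (INR K * q - rsum n (fun j => delta (c j) (c i) * A i j)))
    + lsum (seq 0 r) (fun l =>
        (1 - delta l (c i)) * exp (theta * D)
        * exp (theta * (rsum n (fun j => delta (c j) l * A i j)
                        - rsum n (fun j => delta (c j) (c i) * A i j)))))).
    - intros; apply threshold_excess_term_nonneg.
    - apply in_seq; lia. }
  split.
  - intros i Hi; specialize (H i Hi).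
    assert (X := lsum_nonneg (seq 0 r) _ (threshold_excess_inner_nonneg r (c i) (theta * D)
                   (fun l => theta * (e i l - e i (c i))))).
    cbv beta in X; rewrite <- exp_plus in H.
    assert (Y : theta * D + theta * (INR K * q - e i (c i)) < 0)
      by (apply exp_lt_1_inv; lra).
    apply Rmult_lt_reg_l with theta; lra.
  - intros i l Hi Hl Hne; specialize (H i Hi).
    assert (X := lsum_term_le (seq 0 r) _ l (threshold_excess_inner_nonneg r (c i) (theta * D)
                   (fun l => theta * (e i l - e i (c i)))) ltac:(apply in_seq; lia)).
    cbv beta in X; rewrite delta_neq, Rminus_0_r, Rmult_1_l in X by assumption.
    rewrite <- !exp_plus in *.
    assert (P := exp_pos (theta * D + theta * (INR K * q - e i (c i)))).
    assert (Y : theta * D + theta * (e i l - e i (c i)) < 0)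
      by (apply exp_lt_1_inv; lra).
    apply Rmult_lt_reg_l with theta; lra.
Qed.

Lemma threshold_excess_mean n r K p q c Zs theta D :
  0 <= q <= p -> p <= 1 -> 0 <= theta ->
  (forall i, (i < n)%nat -> (c i < r)%nat) ->
  (forall l, (l < r)%nat -> rsum n (fun i => delta (c i) l) = INR K) ->
  (forall i j, (i < n)%nat -> (j < n)%nat -> Zs i j = delta (c i) (c j)) ->
  sbm_exp n p q Zs (threshold_excess n r K q c theta D)
  <= INR n * ((INR r + 1) * exp (theta * D + p
       + INR K * (q * (exp theta - 1) + p * (exp (- theta) - 1)))).
Proof.
  intros Hq Hp Ht Hc Hsize HZ; unfold threshold_excess; rewrite sbm_exp_lsum.
  rewrite <- (rsum_const n), rsum_lsum; apply lsum_le; intros i Hi; apply in_seq in Hi.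
  rewrite sbm_exp_plus, sbm_exp_scal, sbm_exp_lsum.
  rewrite Rplus_assoc, exp_plus.
  set (b := exp (p + _)).
  assert (ED := exp_pos (theta * D)).
  assert (Hb : 0 < b) by apply exp_pos.
  assert (X0 := proj1 (sbm_exp_threshold n r K p q theta c Zs i 0 Hq Hp Ht
                  ltac:(lia) Hc Hsize HZ)); fold b in X0.
  assert (X1 : lsum (seq 0 r) (fun l => sbm_exp n p q Zs (fun A =>
        (1 - delta l (c i)) * exp (theta * D)
        * exp (theta * (rsum n (fun j => delta (c j) l * A i j)
                        - rsum n (fun j => delta (c j) (c i) * A i j)))))
      <= INR r * (exp (theta * D) * b)).
  { rewrite <- (rsum_const r), rsum_lsum; apply lsum_le; intros l Hl; apply in_seq in Hl.
    rewrite sbm_exp_scal; destruct (Nat.eq_dec l (c i)) as [->|Hne].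
    - rewrite delta_refl, Rminus_diag, !Rmult_0_l.
      apply Rmult_le_pos; lra.
    - rewrite delta_neq, Rminus_0_r, Rmult_1_l by assumption.
      apply Rmult_le_compat_l; [lra|].
      apply (proj2 (sbm_exp_threshold n r K p q theta c Zs i l Hq Hp Ht
                  ltac:(lia) Hc Hsize HZ)); [lia|assumption]. }
  apply Rmult_le_compat_l with (r := exp (theta * D)) in X0; [|lra].
  lra.
Qed.

(* With [exp theta = sqrt (a / b)] the Chernoff exponent is
   [- (sqrt a - sqrt b)^2], which the hypothesis pushes beyond [- r]. *)
Lemma chernoff_exponent (r : nat) (a b : R) :
  0 < b -> b < a -> (1 <= r)%nat -> sqrt a - sqrt b > sqrt (INR r) ->
  exists theta g, 0 < theta /\ 0 < g /\
    b * (exp theta - 1) + a * (exp (- theta) - 1) = - (INR r * (1 + g)).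
Proof.
  intros Hb Hab Hr Hgap.
  assert (Hr0 : 0 < INR r) by (apply lt_0_INR; lia).
  assert (Sb : 0 < sqrt b) by (apply sqrt_lt_R0; lra).
  assert (Sab : sqrt b < sqrt a) by (apply sqrt_lt_1; lra).
  assert (Ea : sqrt a * sqrt a = a) by (apply sqrt_sqrt; lra).
  assert (Eb : sqrt b * sqrt b = b) by (apply sqrt_sqrt; lra).
  assert (Er : sqrt (INR r) * sqrt (INR r) = INR r) by (apply sqrt_sqrt; lra).
  assert (Hr1 : 0 <= sqrt (INR r)) by apply sqrt_pos.
  set (u := sqrt a) in *. set (v := sqrt b) in *.
  assert (Huv : 0 < u / v) by (apply Rdiv_lt_0_compat; lra).
  exists (ln (u / v)), ((u - v) * (u - v) / INR r - 1); split; [|split].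
  - rewrite <- ln_1; apply ln_increasing; [lra|].
    apply Rmult_lt_reg_r with v; [assumption|]; unfold Rdiv.
    rewrite Rmult_assoc, Rinv_l, Rmult_1_r, Rmult_1_l by lra; assumption.
  - assert (X : INR r < (u - v) * (u - v)) by (rewrite <- Er; nra).
    assert (Y : 1 < (u - v) * (u - v) / INR r); [|lra].
    apply Rmult_lt_reg_r with (INR r); [assumption|].
    unfold Rdiv; rewrite Rmult_assoc, Rinv_l, Rmult_1_r, Rmult_1_l by lra; assumption.
  - rewrite exp_Ropp, exp_ln by assumption; rewrite <- Ea, <- Eb; field; lra.
Qed.

(** * Choice of constants and asymptotics *)

Lemma exp_pow (x : R) (n : nat) : exp x ^ n = exp (INR n * x).
Proof.
  induction n as [|n IH]; [simpl; rewrite Rmult_0_l, exp_0; reflexivity|].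
  rewrite S_INR; simpl pow; rewrite IH, <- exp_plus; f_equal; ring.
Qed.

Lemma pow_le_exp (x : R) (n : nat) : 0 <= 1 + x -> (1 + x) ^ n <= exp (INR n * x).
Proof.
  intros Hx; rewrite <- exp_pow; apply pow_incr; split; [assumption|apply one_plus_le_exp].
Qed.

Theorem theorem4 (r : nat) (a b : R) :
  (2 <= r)%nat -> 0 < b -> b < a ->
  sqrt a - sqrt b > sqrt (INR r) ->
  exists c : R, 0 < c /\
  exists K0 : nat, forall K : nat, (K0 <= K)%nat ->
    forall Zs : nat -> nat -> R, in_Znr (r * K) r K Zs ->
      sbm_prob (r * K)
        (a * ln (INR (r * K)) / INR (r * K))
        (b * ln (INR (r * K)) / INR (r * K)) Zs
        (fun A => sdp_unique_opt (r * K) K A Zs)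
      >= 1 - Rpower (INR (r * K)) (- c).
Proof.
  intros Hr Hb Hab Hgap.
  destruct (chernoff_exponent r a b Hb Hab ltac:(lia) Hgap) as (theta & g & Htheta & Hg & Hexp).
  assert (Hr2 : 2 <= INR r) by (apply (le_INR 2); assumption).
  (* A margin [eta * L] multiplies the Chernoff bound by [exp (g / 4 * L)], a quarter of the
     available slack. Half of the margin will be spent: a quarter on [3 * s] and a sixteenth on each
     of the four spectral terms. *)
  set (eta := g / (4 * theta)).
  assert (Heta : 0 < eta) by (apply Rdiv_lt_0_compat; lra).
  (* The degree bound then fails with probability at most
     [n * exp (a * exp 2 * L - C * L) = 1 / n]. *)
  set (C := a * exp 2 + 2).
  assert (He2 : 0 < a * exp 2) by (apply Rmult_lt_0_compat; [lra|apply exp_pos]).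
  assert (HC : 0 < C) by (unfold C; lra).
  (* [alpha] makes [C * L / alpha], and then [del] makes [alpha * kappa], equal to
     [eta * L / 16]. *)
  set (alpha := 16 * C / eta).
  assert (Halpha : 0 < alpha) by (apply Rdiv_lt_0_compat; lra).
  set (del := eta / (16 * alpha)).
  assert (Hdel : 0 < del) by (apply Rdiv_lt_0_compat; lra).
  (* This gives [lam3 * (kappa / 2) = 5 * L], and [beta] gives [p * exp (2 * lam3) * h = L]: the
     sparsity exponent is [- 4 * L]. *)
  set (lam3 := 10 / del).
  assert (Hlam3 : 0 < lam3) by (apply Rdiv_lt_0_compat; lra).
  set (beta := / (a * exp (2 * lam3))).
  assert (Hbeta0 : 0 < a * exp (2 * lam3)) by (apply Rmult_lt_0_compat; [lra|apply exp_pos]).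
  assert (Hbeta : 0 < beta) by (apply Rinv_0_lt_compat, Hbeta0).
  (* The first summand bounds the mean term by [eta * L / 16]; the others give [B * B >= / beta], so
     that the large coordinates number at most [h]. *)
  set (B := 32 * a / eta + / beta + 1).
  assert (HB1 : 0 < 32 * a / eta) by (apply Rdiv_lt_0_compat; lra).
  assert (HB2 : 0 < / beta) by (apply Rinv_0_lt_compat, Hbeta).
  assert (HB : 1 < B) by (unfold B; lra).
  (* [64 * (B * B)] serves the bulk term, [12 * (INR r * INR r)] the condition [r * tau <= K * s]
     with [s = eta * L / 12]. *)
  set (den := 64 * (B * B) + 12 * (INR r * INR r)).
  assert (HBB : 0 < B * B) by (apply Rmult_lt_0_compat; lra).
  assert (Hrr : 0 < INR r * INR r) by (apply Rmult_lt_0_compat; lra).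
  assert (Hden : 0 < den) by (unfold den; lra).
  set (eps := eta / den).
  assert (Heps : 0 < eps) by (apply Rdiv_lt_0_compat; lra).
  (* Small enough that the quadratic term uses at most half of [lam1 * tau], and that
     [lam1 <= 1 / 4]; the exponent left over is at most [- gam * n * L]. *)
  set (lam1 := eps / (16 * a + 4 * eps)).
  assert (Hlam1 : 0 < lam1) by (apply Rdiv_lt_0_compat; lra).
  assert (Hlam1' : lam1 * (16 * a + 4 * eps) = eps) by (unfold lam1; field; lra).
  assert (Hlam1a : lam1 * a * 16 <= eps) by nra.
  assert (Hlam1b : lam1 <= 1 / 4).
  { apply Rmult_le_reg_r with (4 * eps); [lra|].
    assert (0 <= lam1 * a) by (apply Rmult_le_pos; lra). lra. }
  set (gam := lam1 * eps / 2).
  assert (Hgam : 0 < gam) by (unfold gam; assert (X := Rmult_lt_0_compat _ _ Hlam1 Heps); lra).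
  (* The rare events cost [exp (- L)] and the thresholds [exp (- (3 * g / 4) * L)], up to constants;
     halving the smaller exponent absorbs the total factor [cst]. *)
  set (cc := Rmin 1 (3 * g / 4) / 2).
  assert (Hcc : 0 < cc /\ 2 * cc <= 1 /\ 2 * cc <= 3 * g / 4).
  { unfold cc; assert (X := Rmin_l 1 (3 * g / 4)); assert (Y := Rmin_r 1 (3 * g / 4)).
    assert (Z : 0 < Rmin 1 (3 * g / 4)) by (apply Rmin_glb_lt; lra); lra. }
  destruct Hcc as (Hcc0 & Hcc1 & Hcc2).
  (* Sum of the prefactors: 2 for cuts, 1 for degrees, [exp 2] for sparsity, [(INR r + 1) * exp 1]
     for thresholds. *)
  set (cst := 3 + exp 2 + (INR r + 1) * exp 1).
  assert (Hcst : 0 < cst).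
  { unfold cst; assert (X := exp_pos 2); assert (Y := exp_pos 1).
    assert (0 <= (INR r + 1) * exp 1) by (apply Rmult_le_pos; lra); lra. }
  (* The summands ensure in turn [L > 1], [gam * L >= 3] against the [4^n] pairs of sets, the
     absorption of [cst], and [p <= 1]. *)
  set (L0 := 1 + 3 / gam + cst / cc + 4 * a).
  assert (HL0a : 0 < 3 / gam) by (apply Rdiv_lt_0_compat; lra).
  assert (HL0b : 0 < cst / cc) by (apply Rdiv_lt_0_compat; lra).
  exists cc; split; [assumption|].
  destruct (INR_unbounded (exp L0)) as [K0 HK0].
  exists K0; intros K HK Zs HZs.
  destruct (in_Znr_clusters r K Zs HZs) as (c & Hc & Hsize & HZ).
  assert (Hn : INR (r * K) = INR r * INR K) by apply mult_INR.
  assert (HK1 : exp L0 < INR K) by (apply Rlt_le_trans with (1 := HK0), le_INR, HK).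
  assert (EL0 := exp_pos L0).
  assert (HKpos : (1 <= K)%nat).
  { destruct K; [simpl in HK1; lra|lia]. }
  set (n := (r * K)%nat) in *. set (L := ln (INR n)).
  assert (Hnpos : 0 < INR n) by (rewrite Hn; apply Rmult_lt_0_compat; lra).
  assert (HnL : INR n = exp L) by (symmetry; apply exp_ln, Hnpos).
  assert (HL : L0 < L).
  { apply exp_lt_inv; rewrite <- HnL, Hn; nra. }
  assert (HL1 : 1 < L) by (unfold L0 in HL; lra).
  assert (HgamL : 3 <= gam * L).
  { replace 3 with (gam * (3 / gam)) by (field; lra).
    apply Rmult_le_compat_l; unfold L0 in HL; lra. }
  assert (HcstL : cst <= exp (cc * L)).
  { apply Rle_trans with (cc * L); [|assert (X := one_plus_le_exp (cc * L)); lra].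
    replace cst with (cc * (cst / cc)) by (field; lra).
    apply Rmult_le_compat_l; unfold L0 in HL; lra. }
  assert (HLn : L <= INR n) by (rewrite HnL; assert (X := one_plus_le_exp L); lra).
  assert (HaLn : a * L <= INR n).
  { rewrite HnL; replace L with (L / 2 + L / 2) at 2 by field; rewrite exp_plus.
    assert (X := one_plus_le_exp (L / 2)).
    assert (Y : (L / 2) * (L / 2) <= exp (L / 2) * exp (L / 2))
      by (apply Rmult_le_compat; lra).
    assert (Z : 4 * a * L <= L * L) by (apply Rmult_le_compat_r; unfold L0 in HL; lra).
    lra. }
  set (p := a * L / INR n). set (q := b * L / INR n).
  assert (Hpn : p * INR n = a * L) by (unfold p; field; lra).
  assert (Hp1 : p <= 1) by (apply Rmult_le_reg_r with (INR n); lra).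
  assert (Hq : 0 <= q <= p).
  { split; [apply Rlt_le, Rdiv_lt_0_compat; [apply Rmult_lt_0_compat; lra|lra]|].
    apply Rmult_le_reg_r with (INR n); [lra|]; rewrite Hpn.
    replace (q * INR n) with (b * L) by (unfold q; field; lra).
    apply Rmult_le_compat_r; lra. }
  set (tau := eps * INR n * L). set (h := beta * INR n). set (kappa := del * L).
  assert (HnLpos : 0 < INR n * L) by (apply Rmult_lt_0_compat; lra).
  assert (Htau : 0 < tau).
  { unfold tau; rewrite Rmult_assoc; apply Rmult_lt_0_compat; assumption. }
  pose (G := fun A => cut_excess n p q c lam1 tau A + degree_excess n (C * L) A
                      + sparse_excess n h kappa lam3 A
                      + threshold_excess n r K q c theta (eta * L) A).
  apply Rle_ge, Rle_trans with (1 - sbm_exp n p q Zs G).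
  2:{ apply sbm_prob_lower; try assumption.
      - intros gr; unfold G; assert (X1 := cut_excess_nonneg n p q c lam1 tau (adj gr)).
        assert (X2 := degree_excess_nonneg n (C * L) (adj gr)).
        assert (X3 := sparse_excess_nonneg n h kappa lam3 (adj gr)).
        assert (X4 := threshold_excess_nonneg n r K q c theta (eta * L) (adj gr)). lra.
      - intros gr Hlt; unfold G in Hlt.
        assert (X1 := cut_excess_nonneg n p q c lam1 tau (adj gr)).
        assert (X2 := degree_excess_nonneg n (C * L) (adj gr)).
        assert (X3 := sparse_excess_nonneg n h kappa lam3 (adj gr)).
        assert (X4 := threshold_excess_nonneg n r K q c theta (eta * L) (adj gr)).
        destruct (threshold_excess_lt_1 n r K q c theta (eta * L) (adj gr) Htheta ltac:(lra))
          as [T1 T2].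
        apply (sdp_recovery n r K c (adj gr) Zs p q tau (C * L) h kappa B alpha
                 (eta * L / 12) (eta * L)); try assumption; try lia; try lra.
        + apply adj_nonneg.
        + apply adj_sym.
        + apply adj_diag.
        + unfold h; apply Rmult_le_reg_r with (B * B); [assumption|].
          replace (INR n / (B * B) * (B * B)) with (INR n * 1) by (field; lra).
          replace (beta * INR n * (B * B)) with (INR n * (beta * (B * B))) by ring.
          apply Rmult_le_compat_l; [lra|].
          replace 1 with (beta * / beta) by (field; lra).
          apply Rmult_le_compat_l; [lra|].
          apply Rle_trans with B; [unfold B; lra|].
          rewrite <- (Rmult_1_l B) at 1; apply Rmult_le_compat_r; lra.
        + apply Rmult_le_pos; lra.
        + unfold kappa; apply Rmult_le_pos; lra.
        + apply (cut_excess_lt_1 n p q c lam1 tau (adj gr)); lra.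
        + apply (degree_excess_lt_1 n (C * L) (adj gr)); lra.
        + apply (sparse_excess_lt_1 n h kappa lam3 (adj gr)); lra.
        + unfold tau; rewrite Hn.
          assert (Y : eps * (12 * (INR r * INR r)) <= eta).
          { replace eta with (eps * den) by (unfold eps; field; lra).
            apply Rmult_le_compat_l; unfold den; lra. }
          assert (Z : 0 < INR K * L / 12) by (apply Rdiv_lt_0_compat; [apply Rmult_lt_0_compat|]; lra).
          apply Rmult_le_compat_r with (r := INR K * L / 12) in Y; lra.
        + assert (Y1 : 4 * B * B * tau / INR n <= eta * L / 16).
          { replace (4 * B * B * tau / INR n) with (eps * (64 * (B * B)) * (L / 16))
              by (unfold tau; field; lra).
            replace (eta * L / 16) with (eta * (L / 16)) by field.
            apply Rmult_le_compat_r; [lra|].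
            replace eta with (eps * den) by (unfold eps; field; lra).
            apply Rmult_le_compat_l; unfold den; lra. }
          assert (Y2 : 2 * p * INR n / B <= eta * L / 16).
          { replace (2 * p * INR n / B) with (2 * (a * L) / B)
              by (rewrite <- Hpn; field; lra).
            apply Rmult_le_reg_r with B; [lra|].
            replace (2 * (a * L) / B * B) with (eta * L / 16 * (32 * a / eta)) by (field; lra).
            apply Rmult_le_compat_l; [|unfold B; lra].
            assert (0 < eta * L) by (apply Rmult_lt_0_compat; lra); lra. }
          assert (Y3 : alpha * kappa = eta * L / 16) by (unfold kappa, del; field; lra).
          assert (Y4 : C * L / alpha = eta * L / 16) by (unfold alpha; field; lra).
          assert (0 < eta * L) by (apply Rmult_lt_0_compat; lra).
          lra. }
  unfold G; rewrite !sbm_exp_plus.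
  assert (E2c : exp (- L) <= exp (- (2 * cc) * L)).
  { apply exp_mono; assert (X : 2 * cc * L <= 1 * L) by (apply Rmult_le_compat_r; lra); lra. }
  assert (M1 : sbm_exp n p q Zs (cut_excess n p q c lam1 tau) <= 2 * exp (- L)).
  { apply Rle_trans with (1 := cut_excess_mean n p q c lam1 tau Zs Hq Hp1 ltac:(lra) HZ).
    assert (F4 : 4 ^ n <= exp (INR n * 2)).
    { rewrite <- exp_pow; apply pow_incr; split; [lra|].
      replace 2 with (1 + 1) by ring; rewrite exp_plus.
      assert (X := one_plus_le_exp 1).
      replace 4 with ((1 + 1) * (1 + 1)) by ring; apply Rmult_le_compat; lra. }
    replace (8 * (lam1 * lam1) * p * (INR n * INR n)) with (8 * (lam1 * lam1) * a * (INR n * L))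
      by (replace (INR n * L) with (INR n * L * 1) by ring; unfold p; field; lra).
    apply Rle_trans with (exp (INR n * 2) * (2 * exp (- (INR n * 3)))).
    - apply Rmult_le_compat; [apply pow_le; lra| |assumption|].
      + apply Rmult_le_pos; [lra|apply Rlt_le, exp_pos].
      + apply Rmult_le_compat_l; [lra|]; apply exp_mono.
        assert (Y1 : lam1 * a * 16 * (lam1 * (INR n * L) / 2) <= eps * (lam1 * (INR n * L) / 2)).
        { apply Rmult_le_compat_r; [|assumption].
          assert (0 < lam1 * (INR n * L)) by (apply Rmult_lt_0_compat; assumption); lra. }
        assert (Y2 : INR n * 3 <= INR n * (gam * L)) by (apply Rmult_le_compat_l; lra).
        unfold gam in Y2; unfold tau; lra.
    - replace (exp (INR n * 2) * (2 * exp (- (INR n * 3))))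
        with (2 * (exp (INR n * 2) * exp (- (INR n * 3)))) by ring.
      rewrite <- exp_plus; apply Rmult_le_compat_l; [lra|]; apply exp_mono; lra. }
  assert (M2 : sbm_exp n p q Zs (degree_excess n (C * L)) <= exp (- L)).
  { apply Rle_trans with (1 := degree_excess_mean n p q Zs (C * L) Hq Hp1).
    replace (p * exp 2 * INR n) with (a * L * exp 2) by (rewrite <- Hpn; ring).
    rewrite HnL, <- exp_plus; apply exp_mono; unfold C; lra. }
  assert (M3 : sbm_exp n p q Zs (sparse_excess n h kappa lam3) <= exp 2 * exp (- L)).
  { apply Rle_trans with (exp (- (2 * L)) * (1 + 2 * exp (- (2 * L))) ^ n).
    - apply sparse_excess_mean; try assumption; try lra.
      replace (p * exp (2 * lam3) * h) with L
        by (unfold h, beta; rewrite <- (Rmult_1_r L); replace L with (p * INR n / a) at 1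
              by (rewrite Hpn; field; lra); field; split; [apply Rgt_not_eq, exp_pos|lra]).
      replace (lam3 * (kappa / 2)) with (5 * L) by (unfold lam3, kappa; field; lra); lra.
    - assert (X : (1 + 2 * exp (- (2 * L))) ^ n <= exp 2).
      { assert (P := exp_pos (- (2 * L))).
        apply Rle_trans with (1 := pow_le_exp (2 * exp (- (2 * L))) n ltac:(lra)).
        apply exp_mono; rewrite HnL.
        replace (exp L * (2 * exp (- (2 * L)))) with (2 * (exp L * exp (- (2 * L)))) by ring.
        rewrite <- exp_plus.
        assert (Y : exp (L + - (2 * L)) <= 1) by (rewrite <- exp_0; apply exp_mono; lra).
        lra. }
      rewrite (Rmult_comm (exp 2)); apply Rmult_le_compat; try assumption.
      + apply Rlt_le, exp_pos.
      + apply pow_le; assert (P := exp_pos (- (2 * L))); lra.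
      + apply exp_mono; lra. }
  assert (M4 : sbm_exp n p q Zs (threshold_excess n r K q c theta (eta * L))
               <= (INR r + 1) * exp 1 * exp (- (2 * cc) * L)).
  { apply Rle_trans with
      (1 := threshold_excess_mean n r K p q c Zs theta (eta * L) Hq Hp1 (Rlt_le _ _ Htheta) Hc Hsize HZ).
    rewrite HnL.
    (* The factor [r] of the exponent cancels against [K / n = 1 / r]. The union over [n] vertices
       then uses up [L], and [g * L] minus the cost of the margin remains. *)
    replace (INR K * (q * (exp theta - 1) + p * (exp (- theta) - 1)))
      with (- ((1 + g) * L)).
    2:{ transitivity (INR K * L / INR n * (b * (exp theta - 1) + a * (exp (- theta) - 1)));
        [rewrite Hexp, Hn|unfold p, q]; field; [split|]; lra. }
    replace (theta * (eta * L)) with (g / 4 * L) by (unfold eta; field; lra).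
    rewrite (Rmult_comm (exp L)), !Rmult_assoc; apply Rmult_le_compat_l; [lra|].
    rewrite <- !exp_plus; apply exp_mono.
    assert (X : 2 * cc * L <= 3 * g / 4 * L) by (apply Rmult_le_compat_r; lra).
    lra. }
  assert (Htot : cst * exp (- (2 * cc) * L) <= exp (- cc * L)).
  { apply Rle_trans with (exp (cc * L) * exp (- (2 * cc) * L)).
    - apply Rmult_le_compat_r; [apply Rlt_le, exp_pos|assumption].
    - rewrite <- exp_plus; right; f_equal; ring. }
  assert (E3 : exp 2 * exp (- L) <= exp 2 * exp (- (2 * cc) * L))
    by (apply Rmult_le_compat_l; [apply Rlt_le, exp_pos|assumption]).
  unfold Rpower; fold L; unfold cst in Htot; lra.
Qed.
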